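(* Let $S$ be a closed nonnegative symmetric (in general nondensely defined) operator in a separable complex Hilbert space $\mathfrak H$ which admits disjoint nonnegative selfadjoint operator extensions, let $B=(I-S)(I+S)^{-1}$ and $\mathfrak N=\mathfrak H\ominus\operatorname{dom}B$. Let $\{\widetilde B_0,\widetilde B_1\}$ be a pair of selfadjoint contractive extensions of $B$ such that $\widetilde B_0\le\widetilde B_1$, $\ker(\widetilde B_1-\widetilde B_0)=\operatorname{dom}B$, and $$\operatorname{ran}(\widetilde B_1-\widetilde B_0)^{1/2}\cap\operatorname{ran}(\widetilde B_0-B_\mu)^{1/2}=\operatorname{ran}(\widetilde B_1-\widetilde B_0)^{1/2}\cap\operatorname{ran}(B_M-\widetilde B_1)^{1/2}=\{0\},$$ and such that $\widetilde S_k=(I-\widetilde B_k)(I+\widetilde B_k)^{-1}$, $k=0,1$, are nonnegative selfadjoint operators. Define, for $\lambda\in\mathbb C\setminus\mathbb R_+$, $$\widetilde{\mathcal Q}_0(\lambda)=\Big[-I+\tfrac{\lambda+1}{2}(\widetilde B_1-\widetilde B_0)^{1/2}\big(I+(\lambda+1)(\widetilde S_0-\lambda I)^{-1}\big)(\widetilde B_1-\widetilde B_0)^{1/2}\Big]\upharpoonright\mathfrak N,$$ $$\widetilde{\mathcal Q}_1(\lambda)=\Big[I+\tfrac{\lambda+1}{2}(\widetilde B_1-\widetilde B_0)^{1/2}\big(I+(\lambda+1)(\widetilde S_1-\lambda I)^{-1}\big)(\widetilde B_1-\widetilde B_0)^{1/2}\Big]\upharpoonright\mathfrak N.$$ Then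 $\widetilde{\mathcal Q}_0$ belongs to the class $\mathcal S_{\rm F}(\mathfrak N)$, $\widetilde{\mathcal Q}_1$ belongs to the class $\mathcal S_{\rm K}(\mathfrak N)$, and $$\widetilde{\mathcal Q}_0(\lambda)\widetilde{\mathcal Q}_1(\lambda)=\widetilde{\mathcal Q}_1(\lambda)\widetilde{\mathcal Q}_0(\lambda)=-I_{\mathfrak N}\quad\text{for each }\lambda\in\mathbb C\setminus\mathbb R_+.$$
   Context: Here $\mathbb R_+=[0,\infty)$ and $\mathbf L(\mathcal H)$ denotes the bounded operators on $\mathcal H$. Two extensions $S',S''$ of $S$ are disjoint if $S'\cap S''=S$ (intersection of graphs). The operator $B=(I-S)(I+S)^{-1}$ is a Hermitian contraction, defined on the closed subspace $\operatorname{dom}B=\operatorname{ran}(I+S)$: $(Bf,g)=(f,Bg)$ for $f,g\in\operatorname{dom}B$ and $\|B\|\le1$. A selfadjoint contractive extension ($sc$-extension) of $B$ is a selfadjoint contraction on all of $\mathfrak H$ extending $B$. By Kreĭn, the set of all $sc$-extensions of $B$ is an operator interval $[B_\mu,B_M]$, with smallest element $B_\mu$ and largest element $B_M$. For an operator-valued function, Herglotz–Nevanlinna on $\mathbb C\setminus\mathbb R_+$ means holomorphic there, with $\mathcal M(\bar\lambda)=\mathcal M(\lambda)^*$ and $\operatorname{Im}\lambda\cdot\operatorname{Im}\mathcal M(\lambda)\ge0$. For a separable Hilbert space $\mathcal H$, $\mathcal S_{\rm F}(\mathcal H)$ is the class of Herglotz–Nevanlinna $\mathbf L(\mathcal H)$-valued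 functions $\mathcal M$ holomorphic on $\mathbb C\setminus\mathbb R_+$ such that: (1) $\mathcal M^{-1}(\lambda)\in\mathbf L(\mathcal H)$ for all $\lambda\in\mathbb C\setminus\mathbb R_+$; (2) $s\text{-}\lim_{x\uparrow0}\mathcal M(x)=0$; (3) $\lim_{x\downarrow-\infty}(\mathcal M(x)g,g)=-\infty$ for each $g\in\mathcal H\setminus\{0\}$; (4) $s\text{-}\lim_{x\downarrow-\infty}x^{-1}\mathcal M(x)=0$. $\mathcal S_{\rm K}(\mathcal H)$ is the class of Herglotz–Nevanlinna $\mathbf L(\mathcal H)$-valued functions $\mathcal N$ holomorphic on $\mathbb C\setminus\mathbb R_+$ such that: (1) $\mathcal N^{-1}(\lambda)\in\mathbf L(\mathcal H)$ for all $\lambda\in\mathbb C\setminus\mathbb R_+$; (2) $\lim_{x\uparrow0}(\mathcal N(x)g,g)=+\infty$ for each $g\in\mathcal H\setminus\{0\}$; (3) $s\text{-}\lim_{x\downarrow-\infty}\mathcal N(x)=0$; (4) $\lim_{x\downarrow-\infty}x(\mathcal N(x)g,g)=-\infty$ for each $g\in\mathcal H\setminus\{0\}$. *)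

(* Defs.v *)
From HB Require Import structures.
From mathcomp Require Import all_boot all_order all_algebra.
From mathcomp Require Import all_classical all_reals all_analysis.
From mathcomp Require Import sesquilinear complex.

Set Implicit Arguments.
Unset Strict Implicit.
Unset Printing Implicit Defensive.

Import Order.TTheory GRing.Theory Num.Theory numFieldNormedType.Exports.

Local Open Scope classical_set_scope.
Local Open Scope ring_scope.
Local Open Scope complex_scope.

(* A Hilbert space over R[i] is a complete normed module H whose norm comes
   from a dot product ip (linear in the first argument, antilinear in the
   second). *)
Definition hilbert_dot (R : realType) (H : completeNormedModType R[i])
    (ip : {dot H for @Num.conj R[i]}) : Prop :=
  forall x : H, ip x x = `|x| ^+ 2.

Definition separable (T : topologicalType) : Prop :=
  exists2 D : set T, countable D & dense D.

(* Operators, possibly not everywhere defined, are represented by their graphs;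
   the algebraic operations below are the usual ones for partial operators,
   e.g. the domain of a sum is the intersection of the domains. *)
Section Graphs.
Context {R : realType} {H : completeNormedModType R[i]}.

Definition graph := set (H * H).

Implicit Types (A : graph) (N : set H).

Definition op_dom A : set H := [set x | exists y, A (x, y)].
Definition op_ran A : set H := [set y | exists x, A (x, y)].
Definition op_ker A : set H := [set x | A (x, 0)].

Definition op_id : graph := [set p | p.2 = p.1].
Definition op_scale (c : R[i]) A : graph :=
  [set p | exists2 y, A (p.1, y) & p.2 = c *: y].
Definition op_add A1 A2 : graph :=
  [set p | exists y1 y2, [/\ A1 (p.1, y1), A2 (p.1, y2) & p.2 = y1 + y2]].
Definition op_sub A1 A2 : graph := op_add A1 (op_scale (-1) A2).
(* op_comp A1 A2 is A1 A2, i.e. A2 acts first. *)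
Definition op_comp A1 A2 : graph :=
  [set p | exists2 y, A2 (p.1, y) & A1 (y, p.2)].
Definition op_inv A : graph := [set p | A (p.2, p.1)].
Definition op_restr A N : graph := [set p | N p.1 /\ A p].

(* The value A x (0 when x is outside the domain of A). *)
Definition op_val A (x : H) : H := xget 0 [set y | A (x, y)].

Definition linear_graph A : Prop :=
  A (0, 0) /\ forall (c : R[i]) x1 y1 x2 y2,
    A (x1, y1) -> A (x2, y2) -> A (c *: x1 + x2, c *: y1 + y2).
Definition is_operator A : Prop :=
  linear_graph A /\ forall x y1 y2, A (x, y1) -> A (x, y2) -> y1 = y2.

(* L(N) for a closed subspace N, regarded as a Hilbert space of its own. *)
Definition bounded_op N A : Prop :=
  [/\ is_operator A, op_dom A = N, op_ran A `<=` N &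
      exists c : R, forall x y, A (x, y) -> `|y| <= c%:C * `|x| ].

Definition contractive A : Prop := forall x y, A (x, y) -> `|y| <= `|x|.

Definition cayley A : graph := op_comp (op_sub op_id A) (op_inv (op_add op_id A)).

End Graphs.

Arguments graph {R} H.

Section Hilbert.
Context {R : realType} {H : completeNormedModType R[i]}.
Variable ip : {dot H for @Num.conj R[i]}.

Implicit Types (A : graph H) (N : set H).

Definition orthocompl (D : set H) : set H :=
  [set x | forall y, D y -> ip x y = 0].

(* In R[i], 0 <= z means that z is real and nonnegative. *)
Definition op_nonneg A : Prop := forall x y, A (x, y) -> 0 <= ip y x.
Definition op_le A1 A2 : Prop := op_nonneg (op_sub A2 A1).

Definition symmetric_op A : Prop :=
  forall f f' g g', A (f, f') -> A (g, g') -> ip f' g = ip f g'.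

(* Adjoint with respect to the Hilbert space N. *)
Definition op_adj N A : graph H :=
  [set p | [/\ N p.1, N p.2 & forall u v, A (u, v) -> ip v p.1 = ip u p.2]].

Definition nonneg_selfadjoint A : Prop :=
  [/\ is_operator A, dense (op_dom A), A = op_adj setT A & op_nonneg A].

Definition sc_extension (B A : graph H) : Prop :=
  [/\ bounded_op setT A, A = op_adj setT A, contractive A & B `<=` A].

(* The operators below are specified uniquely; should none exist, the value is
   the empty graph, whose range does not even contain 0. *)
Definition B_mu (B : graph H) : graph H :=
  xget set0 [set A | sc_extension B A /\
                     forall A', sc_extension B A' -> op_le A A'].
Definition B_M (B : graph H) : graph H :=
  xget set0 [set A | sc_extension B A /\
                     forall A', sc_extension B A' -> op_le A' A].
Definition op_sqrt A : graph H :=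
  xget set0 [set T | [/\ bounded_op setT T, T = op_adj setT T, op_nonneg T &
                         op_comp T T = A]].

(* C \ R_+ *)
Definition slit_plane : set R[i] := ~` [set t%:C | t in [set t : R | 0 <= t]].

Definition op_im N A : graph H :=
  op_scale (2 * 'i)^-1 (op_sub A (op_adj N A)).

(* Complex differentiability in the operator norm of L(N). *)
Definition holomorphic_at N (M : R[i] -> graph H) (l : R[i]) : Prop :=
  exists2 D : graph H, bounded_op N D &
    forall eps : R[i], 0 < eps -> exists2 delta : R[i], 0 < delta &
      forall m, 0 < `|m - l| < delta -> forall g, N g ->
        `| (m - l)^-1 *: (op_val (M m) g - op_val (M l) g) - op_val D g |
          <= eps * `|g|.

Definition herglotz_nevanlinna N (M : R[i] -> graph H) : Prop :=
  forall l, slit_plane l ->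
    [/\ bounded_op N (M l), holomorphic_at N M l,
        M (Num.conj l) = op_adj N (M l) &
        op_nonneg (op_scale (complex.Im l)%:C (op_im N (M l)))].

(* (A g, g), which is a real number when A is selfadjoint. *)
Definition op_form A (g : H) : R := complex.Re (ip (op_val A g) g).

Definition class_SF N (M : R[i] -> graph H) : Prop :=
  herglotz_nevanlinna N M /\
  [/\ forall l, slit_plane l -> bounded_op N (op_inv (M l)),
      forall g, N g -> op_val (M x%:C) g @[x --> (0 : R)^'-] --> (0 : H),
      forall g, N g -> g != 0 -> op_form (M x%:C) g @[x --> (-oo)%R] --> -oo &
      forall g, N g ->
        (x%:C)^-1 *: op_val (M x%:C) g @[x --> (-oo)%R] --> (0 : H)].

Definition class_SK N (M : R[i] -> graph H) : Prop :=
  herglotz_nevanlinna N M /\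
  [/\ forall l, slit_plane l -> bounded_op N (op_inv (M l)),
      forall g, N g -> g != 0 ->
        op_form (M x%:C) g @[x --> (0 : R)^'-] --> +oo,
      forall g, N g -> op_val (M x%:C) g @[x --> (-oo)%R] --> (0 : H) &
      forall g, N g -> g != 0 ->
        x * op_form (M x%:C) g @[x --> (-oo)%R] --> -oo].

(* The function
     [ s I + (l+1)/2 T (I + (l+1) (A - l I)^-1) T ] restricted to N. *)
Definition Q_fun N (s : R[i]) (T A : graph H) (l : R[i]) : graph H :=
  op_restr
    (op_add (op_scale s op_id)
       (op_scale ((l + 1) / 2)
          (op_comp T
             (op_comp
                (op_add op_id
                   (op_scale (l + 1) (op_inv (op_sub A (op_scale l op_id)))))
                T))))
    N.

End Hilbert.

(* Main.v *)
Require Import Defs.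
From HB Require Import structures.
From mathcomp Require Import all_boot all_order all_algebra.
From mathcomp Require Import all_classical all_reals all_analysis.
From mathcomp Require Import sesquilinear complex.
From mathcomp Require Import ring lra.

(* On H, write Q_k = -+ I + (l + 1) X P_k(l)^-1 X, where X^2 = B1 - B0 and
   P_k(l) = (1 - l) - (1 + l) B_k: the Cayley transform turns
   I + (l + 1) (S_k - l)^-1 into 2 P_k(l)^-1. The pencil P_k(l) is invertible for
   l outside R_+ because its numerical range lies in the segment [-2 l, 2], and
   P_0 - P_1 = (1 + l) X^2 gives Q_0 Q_1 = Q_1 Q_0 = - I.
   Near 0 and near -oo, respectively, Q_1 and - Q_0 have the form
   F_e = I + X (1 + e - T)^-1 X with e decreasing to 0, T = B1 or T = - B0, and the
   other function is, up to sign, F_e^-1. All the limits reduce to two facts. The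
   forms (F_e g, g) increase to +oo if X g <> 0: a bound M would make the rank one
   operator M^-1 (., X g) X g smaller than I - T, hence smaller than B_M - B1
   (resp. B0 - B_mu), and X g would be in the range of the square root of the
   latter. And e F_e g tends to 0, as the range of I + B0 is dense. *)

Set Implicit Arguments.
Unset Strict Implicit.
Unset Printing Implicit Defensive.

Import Order.TTheory GRing.Theory Num.Theory numFieldNormedType.Exports.

Local Open Scope classical_set_scope.
Local Open Scope ring_scope.
Local Open Scope complex_scope.

(** * The real inner product *)

(** The operators I - T have no bounded inverse in general, so limits as e decreases to 0 are never
    taken on resolvents directly. They are taken on quadratic forms, through the variational formula
    (A^-1 v, v) = sup_h 2 Re (v, h) - (A h, h) for positive A. It yields monotonicity in e, removes
    e from a bound on F_e, and bounds F_e^-1 from below. A second tool does double duty: v lies in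
    the range of an adjoint Y* as soon as (h, v)^2 <= M |Y h|^2 for all h. It gives the
    invertibility of the pencil, and it puts X g in the range of the square roots of B_M - B1 and B0
    - B_mu. The points [near0 e] and [nearNy e] are chosen so that the pencils factor there as P_1 =
    (1 + x) (1 + e - B1) and P_0 = - (1 + x) (1 + e + B0). The scalar cancels the factor l + 1 of
    Q_k, so one abstract family F_e serves both ends of the half-line. *)

Section RealForm.
Context {R : realType} {H : completeNormedModType R[i]}.
Variable ip : {dot H for @Num.conj R[i]}.

(** With the real part, estimates become arithmetic over [R]; [sq] is the squared norm as an element
    of [R], whereas the norm of [H] has values in [R[i]]. *)
Definition rip (x y : H) : R := complex.Re (ip x y).
Definition sq (x : H) : R := rip x x.

Lemma ReD (a b : R[i]) : complex.Re (a + b) = complex.Re a + complex.Re b.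
Proof. by case: a; case: b. Qed.

Lemma ReM (a b : R[i]) : complex.Re (a * b) =
  complex.Re a * complex.Re b - complex.Im a * complex.Im b.
Proof. by case: a; case: b. Qed.

Lemma ipC x y : ip x y = Num.conj (ip y x).
Proof. by rewrite (hermC ip x y) expr0 mul1r. Qed.

Lemma ipDl x y z : ip (x + y) z = ip x z + ip y z.
Proof. by rewrite linearDl. Qed.

Lemma ipDr x y z : ip z (x + y) = ip z x + ip z y.
Proof. by rewrite linearDr. Qed.

Lemma ipZl (c : R[i]) x y : ip (c *: x) y = c * ip x y.
Proof. by rewrite linearZl_LR. Qed.

Lemma ipNl x y : ip (- x) y = - ip x y.
Proof. by rewrite linearNl. Qed.

Lemma ipZr (c : R[i]) x y : ip x (c *: y) = Num.conj c * ip x y.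
Proof. by rewrite linearZr_LR. Qed.

Lemma ripC x y : rip x y = rip y x.
Proof. by rewrite /rip ipC; case: (ip y x). Qed.

Lemma ImipC x y : complex.Im (ip x y) = - complex.Im (ip y x).
Proof. by rewrite ipC; case: (ip y x). Qed.

Lemma ripDl x y z : rip (x + y) z = rip x z + rip y z.
Proof. by rewrite /rip linearDl ReD. Qed.

Lemma ripDr x y z : rip z (x + y) = rip z x + rip z y.
Proof. by rewrite ripC ripDl !(ripC z). Qed.

Lemma ripNl x z : rip (- x) z = - rip x z.
Proof. by rewrite -scaleN1r /rip ipZl ReM /= mulN1r oppr0 mul0r subr0. Qed.

Lemma ripNr x z : rip z (- x) = - rip z x.
Proof. by rewrite ripC ripNl ripC. Qed.

Lemma ripZl (a : R) x z : rip (a%:C *: x) z = a * rip x z.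
Proof. by rewrite /rip ipZl ReM /= mul0r subr0. Qed.

Lemma ripZr (a : R) x z : rip z (a%:C *: x) = a * rip z x.
Proof. by rewrite ripC ripZl ripC. Qed.

Definition ripE := (ripDl, ripDr, ripNl, ripNr, ripZl, ripZr).

Lemma Im_rip x y : complex.Im (ip x y) = - rip ('i *: x) y.
Proof. by rewrite /rip ipZl ReM /= mul0r mul1r sub0r opprK. Qed.

Lemma rip0l x : rip 0 x = 0.
Proof. by rewrite /rip linear0l. Qed.

Lemma rip0r x : rip x 0 = 0.
Proof. by rewrite ripC rip0l. Qed.

Hypothesis ip_norm : hilbert_dot ip.

Lemma ip_sq x : ip x x = (sq x)%:C.
Proof.
apply/eqP; rewrite eq_complex /= eqxx /=; apply/eqP.
by have := ImipC x x; lra.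
Qed.

Lemma normE x : `|x| ^+ 2 = (sq x)%:C.
Proof. by rewrite -ip_norm ip_sq. Qed.

Lemma sq_ge0 x : 0 <= sq x.
Proof. by rewrite -ler0c -normE exprn_ge0. Qed.

Lemma sq_eq0 x : sq x = 0 -> x = 0.
Proof.
move=> e; apply/eqP; rewrite -normr_eq0 -sqrf_eq0 normE e.
by rewrite eqxx.
Qed.

Lemma sq0 : sq 0 = 0. Proof. exact: rip0l. Qed.

Lemma sq_gt0 x : x != 0 -> 0 < sq x.
Proof.
move=> x0; rewrite lt_neqAle sq_ge0 andbT eq_sym.
by apply: contra x0 => /eqP/sq_eq0 ->.
Qed.

Lemma rip_eq x y : (forall z, rip x z = rip y z) -> x = y.
Proof.
move=> e; apply/eqP; rewrite -subr_eq0; apply/eqP/sq_eq0.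
by rewrite /sq ripDl ripNl e subrr.
Qed.

(* Reduces vector identities to scalar ones, where ring and field apply. *)
Lemma ip_eq x y : (forall z, ip x z = ip y z) -> x = y.
Proof. by move=> e; apply: rip_eq => z; rewrite /rip e. Qed.

Lemma sqZ (c : R[i]) x :
  sq (c *: x) = (complex.Re c ^+ 2 + complex.Im c ^+ 2) * sq x.
Proof.
have h : (sq (c *: x))%:C = Num.conj c * c * (sq x)%:C.
  by rewrite -!ip_sq ipZl ipZr; ring.
have := congr1 (@complex.Re R) h => /= ->.
by case: c {h} => a b /=; ring.
Qed.

Lemma sqZr (a : R) x : sq (a%:C *: x) = a ^+ 2 * sq x.
Proof. by rewrite sqZ /= expr0n /= addr0. Qed.

Lemma sqN x : sq (- x) = sq x.
Proof. by rewrite /sq !ripE opprK. Qed.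

Lemma rip_CS x y : rip x y ^+ 2 <= sq x * sq y.
Proof.
have := sq_ge0 ((sq y)%:C *: x - (rip x y)%:C *: y).
rewrite /sq !ripE -/(sq x) -/(sq y) (ripC y x) => h.
have [y0|y0] := eqVneq y 0; first by rewrite y0 rip0r sq0 expr0n mulr0.
rewrite -subr_ge0 -(pmulr_rge0 _ (sq_gt0 y0)).
by apply: le_trans h _; rewrite le_eqVlt; apply/orP; left; apply/eqP; ring.
Qed.

Lemma rip_le1 x y : 2 * rip x y <= sq x + sq y.
Proof.
have := sq_ge0 (x - y); rewrite /sq !ripE (ripC y x); lra.
Qed.

Lemma sqD_le x y : sq (x + y) <= 2 * sq x + 2 * sq y.
Proof.
have := sq_ge0 (x - y); rewrite /sq !ripE (ripC y x); lra.
Qed.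

Lemma norm_lt_sq x (e : R) : 0 < e -> (`|x| < e%:C) = (sq x < e ^+ 2).
Proof.
move=> e0; have e0' : 0 <= e%:C by rewrite ler0c ltW.
rewrite -(ltr_pXn2r (_ : 0 < 2)%N) ?nnegrE // normE -rmorphXn /=.
by rewrite ltcR.
Qed.

Lemma norm_le_sq x y (e : R) : 0 <= e ->
  (`|x| <= e%:C * `|y|) = (sq x <= e ^+ 2 * sq y).
Proof.
move=> e0; have e0' : 0 <= e%:C by rewrite ler0c.
rewrite -(ler_pXn2r (_ : 0 < 2)%N) ?nnegrE ?mulr_ge0 // exprMn !normE -rmorphXn /=.
by rewrite -rmorphM /= lecR.
Qed.

Lemma contractive_sq x y : (`|x| <= `|y|) = (sq x <= sq y).
Proof.
by rewrite -[X in _ <= X]mul1r norm_le_sq ?ler01 // expr1n mul1r.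
Qed.

Lemma posC (e : R[i]) : 0 < e -> exists2 r : R, 0 < r & e = r%:C.
Proof.
case: e => a b; rewrite ltcE /= => /andP[/eqP -> a0]; by exists a.
Qed.

(** A general filter is allowed because completeness is used both for a minimizing sequence and for
    e -> 0 from the right. *)
Lemma cauchy_net (T : Type) (F : set_system T) (FF : ProperFilter F) (f : T -> H) :
  (forall e : R, 0 < e -> exists a, \forall t \near F, sq (f t - f a) < e) ->
  exists k : H, forall e : R, 0 < e -> \forall t \near F, sq (f t - k) < e.
Proof.
move=> h.
have Fc : cauchy (f @ F).
  apply: cauchy_exP => e /posC [r r0 ->].
  have [a ha] := h (r ^+ 2) (exprn_gt0 _ r0).
  exists (f a); rewrite /fmap /=; apply: filterS ha => t ht.
  by rewrite -ball_normE /= distrC norm_lt_sq.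
have Fcvg : f @ F --> lim (f @ F) by apply: cauchy_cvg.
exists (lim (f @ F)) => e e0.
have /cvgrPdist_lt/(_ (Num.sqrt e)%:C) := Fcvg.
rewrite ltcR sqrtr_gt0 => /(_ e0); apply: filterS => t.
by rewrite distrC norm_lt_sq ?sqrtr_gt0 // sqr_sqrtr // ltW.
Qed.

End RealForm.

(** * Range of an adjoint and invertibility *)

(** The first variation at a minimum vanishes. At [t = d / (s + 1)] the left side equals
    [t ^+ 2 * (s + 1)], which exceeds [t ^+ 2 * s] unless t = 0. *)
Lemma quadratic_flat (R : realType) (s d : R) :
  0 <= s -> (forall t, t * d <= t ^+ 2 * s) -> d = 0.
Proof.
move=> s0 h; have s1 : 0 < s + 1 by lra.
have := h (d / (s + 1)).
have -> : d / (s + 1) * d = (d / (s + 1)) ^+ 2 * (s + 1).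
  by field; rewrite gt_eqF.
rewrite mulrDr mulr1 gerDl => /(conj (sqr_ge0 (d / (s + 1))))/andP/le_anti/esym/eqP.
by rewrite sqrf_eq0 mulf_eq0 invr_eq0 (gt_eqF s1) orbF => /eqP.
Qed.

Section Riesz.
Context {R : realType} {H : completeNormedModType R[i]}.
Variable ip : {dot H for @Num.conj R[i]}.
Hypothesis ip_norm : hilbert_dot ip.
Local Notation rip := (rip ip).
Local Notation sq := (sq ip).

(* The vector w is the limit of Y h_n along a sequence minimizing
   |Y h|^2 - 2 Re (h, v). *)
Lemma range_adjoint (Y : {linear H -> H}) (Ya : H -> H) (v : H) (M : R) :
  (forall x y, rip (Y x) y = rip x (Ya y)) -> 0 <= M ->
  (forall h, rip h v ^+ 2 <= M * sq (Y h)) -> exists w, v = Ya w.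
Proof.
move=> adj M0 hM.
pose J h := sq (Y h) - 2 * rip h v.
(* With s = |Y h|^2 and r = (h, v): (2 r)^2 <= 4 M s <= (s + M)^2. *)
have Jlb h : - M <= J h.
  have s0 := sq_ge0 ip_norm (Y h); have := hM h; rewrite /J.
  set s := sq _ in s0 *; set r := rip h v => hr.
  have : (2 * r) ^+ 2 <= (s + M) ^+ 2 by have := sqr_ge0 (s - M); lra.
  move=> h2; rewrite leNgt; apply/negP => h1.
  suff : 0 < (2 * r - (s + M)) * (2 * r + (s + M)) by lra.
  by apply: mulr_gt0; lra.
pose E := [set J h | h in [set: H]].
have Elb : has_inf E.
  by split; [exists (J 0), 0 | exists (- M) => _ [h _ <-]].
pose m := inf E.
have mJ h : m <= J h by apply: ge_inf; [exact: Elb.2 | exists h].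
have hseq (n : nat) : exists h, J h < m + n.+1%:R^-1.
  have [] := inf_adherent (eps := n.+1%:R^-1) _ Elb; first by rewrite invr_gt0.
  by move=> _ [h _ <-] hh; exists h.
have {hseq}[h hJ] := choice hseq.
(* The parallelogram identity makes Y h_n Cauchy; the sequence h_n itself need not converge. *)
have par a b : sq (Y a - Y b) = 2 * J a + 2 * J b - 4 * J ((2^-1 : R)%:C *: (a + b)).
  rewrite /J (linearZ_LR Y) (linearD Y) sqZr // !ripZl ripDl /sq !ripE.
  by rewrite (ripC _ (Y b)); field.
have [w hw] : exists w, forall e : R, 0 < e -> \forall n \near \oo, sq (Y (h n) - w) < e.
  apply: (cauchy_net ip_norm) => e e0.
  have [n0 _ hn0] : \forall n \near \oo, n.+1%:R^-1 < e / 4 :> R.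
    by apply: near_infty_natSinv_lt (PosNum _); lra.
  exists n0; exists n0 => // n /= /hn0 /= hn; rewrite par.
  have := hn0 _ (leqnn n0); have := hJ n; have := hJ n0.
  have := mJ ((2^-1 : R)%:C *: (h n + h n0)) => /=.
  move: hn; move: (J (h n)) (J (h n0)) (J _) => a b c.
  move: (n.+1%:R^-1) (n0.+1%:R^-1) => x y; lra.
(* First variation in the direction [k]: J (h_n + t k) >= m gives (Y k, w) = (k, v) in the limit. *)
exists w; apply: (rip_eq ip_norm) => k.
rewrite (ripC _ (Ya w)) -adj (ripC _ v); apply/eqP; rewrite -subr_eq0; apply/eqP.
apply: (@quadratic_flat R (sq (Y k))); first exact: sq_ge0.
move=> t; apply/ler_addgt0Pr => e e0.
have [n [hn1 hn2]] : exists n, J (h n) < m + e /\ sq (Y (h n) - w) < e.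
  have [n1 _ hn1] : \forall n \near \oo, n.+1%:R^-1 < e :> R.
    exact: near_infty_natSinv_lt (PosNum e0).
  have [n2 _ hn2] := hw _ e0.
  exists (maxn n1 n2); split; last exact/hn2/leq_maxr.
  by apply: lt_le_trans (hJ _) _; rewrite lerD2l ltW//; apply/hn1/leq_maxl.
have := mJ (h n + t%:C *: k).
have := rip_le1 ip_norm (Y (h n) - w) (t%:C *: Y k).
move: hn1 hn2; rewrite sqZr // /J (linearD Y) (linearZ_LR Y) /sq !ripE.
rewrite (ripC _ (Y k) (Y (h n))) (ripC _ (Y k) w) (ripC _ w (Y (h n))); lra.
Qed.

(** The bound on [P] gives injectivity, the one on [Pa] surjectivity: (h, v)^2 <= |v|^2 |h|^2 <=
    (|v|^2 / c) |Pa h|^2, so [range_adjoint] applies to [Pa], whose adjoint is [P]. *)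
Lemma bounded_below_inv (P Pa : {linear H -> H}) (c : R) :
  (forall x y, rip (P x) y = rip x (Pa y)) -> 0 < c ->
  (forall h, c * sq h <= sq (P h)) -> (forall h, c * sq h <= sq (Pa h)) ->
  exists r : {linear H -> H}, cancel r P /\ cancel P r.
Proof.
move=> adj c0 hP hPa.
have surj v : exists w, P w = v.
  have [||h|w ->] := @range_adjoint Pa P v (sq v / c); last by exists w.
  - by move=> x y; rewrite ripC -adj ripC.
  - by rewrite divr_ge0 ?sq_ge0 // ltW.
  apply: le_trans (rip_CS ip_norm _ _) _.
  rewrite mulrC -mulrA ler_wpM2l ?sq_ge0 //.
  by rewrite ler_pdivlMl.
have inj x y : P x = P y -> x = y.
  move=> e; apply/eqP; rewrite -subr_eq0; apply/eqP/(sq_eq0 ip_norm).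
  apply/le_anti; rewrite sq_ge0 // andbT -(pmulr_rle0 _ c0).
  by apply: le_trans (hP _) _; rewrite (linearB P) /= e subrr sq0.
have [r rP] := choice surj.
have Pr : cancel P r by move=> x; apply: inj.
have rl : linear r by move=> a x y; apply: inj; rewrite linearP /= !rP.
pose rL := GRing.isLinear.Build _ _ _ _ r rl.
pose r' : {linear H -> H} := HB.pack r rL.
by exists r'.
Qed.

End Riesz.

(** * Limits of I + X (1 + e - T)^-1 X and of its inverse *)

Section Core.
Context {R : realType} {H : completeNormedModType R[i]}.
Variable ip : {dot H for @Num.conj R[i]}.
Hypothesis ip_norm : hilbert_dot ip.
Local Notation rip := (rip ip).
Local Notation sq := (sq ip).

(** Expanding, (A (h - k), h - k) = (A h, h) - 2 (v, h) + (v, k), and (A h, h) <= (A' h, h) = (v,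
    h). Keeping the left side, rather than just its sign, is what later makes [K] a Cauchy net. *)
Lemma inverse_antitone (A A' : {linear H -> H}) (v k h : H) :
  (forall x y, rip (A x) y = rip x (A y)) ->
  (forall u, rip (A u) u <= rip (A' u) u) -> A k = v -> A' h = v ->
  rip (A (h - k)) (h - k) <= rip v k - rip v h.
Proof.
move=> As AA' Ak A'h.
by have := AA' h; rewrite A'h (linearB A) !ripE Ak (As h k) Ak (ripC _ h v); lra.
Qed.

Variables T X : {linear H -> H}.
Hypothesis T_sym : forall x y, rip (T x) y = rip x (T y).
Hypothesis T_le : forall h, `|rip (T h) h| <= sq h.
Hypothesis X_sym : forall x y, rip (X x) y = rip x (X y).

Definition shift (e : R) (h : H) : H := (1 + e)%:C *: h - T h.

Lemma shift_linear e : linear (shift e).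
Proof.
move=> a x y; rewrite /shift linearP scalerDr !scalerA mulrC -scalerA.
by rewrite scalerBr opprD addrACA.
Qed.
HB.instance Definition _ e := GRing.isLinear.Build _ _ _ _ (shift e) (shift_linear e).

Lemma shiftB e x y : shift e (x - y) = shift e x - shift e y.
Proof. exact: linearB. Qed.

Lemma shift_sym e x y : rip (shift e x) y = rip x (shift e y).
Proof. by rewrite /shift !ripE T_sym. Qed.

Lemma shift_form e h : rip (shift e h) h = (1 + e) * sq h - rip (T h) h.
Proof. by rewrite /shift !ripE. Qed.

Lemma shift_ge e h : e * sq h <= rip (shift e h) h.
Proof. by rewrite shift_form; have := T_le h; rewrite ler_norml; lra. Qed.

Lemma shift_le d e h : d <= e -> rip (shift d h) h <= rip (shift e h) h.
Proof.
by move=> de; rewrite !shift_form lerD2r ler_wpM2r ?sq_ge0 // lerD2l.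
Qed.

Lemma shift_ge_sq e h : 0 < e -> e ^+ 2 * sq h <= sq (shift e h).
Proof.
move=> e0; have h1 := shift_ge e h; have := rip_CS ip_norm (shift e h) h.
have [->|h0] := eqVneq h 0; first by rewrite sq0 !mulr0 sq_ge0.
rewrite -(ler_pM2r (sq_gt0 ip_norm h0)); apply: le_trans.
rewrite -mulrA -expr2 -exprMn ler_pXn2r ?nnegrE //.
  by rewrite mulr_ge0 ?sq_ge0 // ltW.
by apply: le_trans h1; rewrite mulr_ge0 ?sq_ge0 // ltW.
Qed.

(** Specified by equations only, since they are instantiated by scaled resolvents and, up to sign,
    by the two Q-functions, which are inverse to each other up to sign. *)
Variables G F K : R -> H -> H.
Hypothesis shiftG : forall e v, 0 < e -> shift e (G e v) = v.
Hypothesis FE : forall e g, 0 < e -> F e g = g + X (G e (X g)).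
Hypothesis FK : forall e g, 0 < e -> F e (K e g) = g.

Lemma G_sym e x y : 0 < e -> rip (G e x) y = rip x (G e y).
Proof. by move=> e0; rewrite -{1}(shiftG y e0) -shift_sym shiftG. Qed.

Lemma F_form e g : 0 < e -> rip (F e g) g = sq g + rip (G e (X g)) (X g).
Proof. by move=> e0; rewrite FE // ripDl X_sym. Qed.

Lemma F_sym e x y : 0 < e -> rip (F e x) y = rip x (F e y).
Proof. by move=> e0; rewrite !FE // !ripE !X_sym G_sym // -X_sym. Qed.

Lemma G_ge0 e v : 0 < e -> 0 <= rip (G e v) v.
Proof.
move=> e0; rewrite -{2}(shiftG v e0) ripC.
by apply: le_trans (shift_ge _ _); rewrite mulr_ge0 ?sq_ge0 // ltW.
Qed.

Lemma F_ge e g : 0 < e -> sq g <= rip (F e g) g.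
Proof. by move=> e0; rewrite F_form // lerDl G_ge0. Qed.

Lemma F_le d e g : 0 < d -> d <= e -> rip (F e g) g <= rip (F d g) g.
Proof.
move=> d0 de; have e0 := lt_le_trans d0 de.
rewrite !F_form // lerD2l !(ripC _ _ (X g)) -subr_ge0.
apply: le_trans (inverse_antitone (shift_sym d) _ (shiftG _ d0) (shiftG _ e0)).
  by apply: le_trans (shift_ge _ _); rewrite mulr_ge0 ?sq_ge0 // ltW.
by move=> u; apply: shift_le.
Qed.

(** The lower bound makes [shift e] injective, which forces its right inverse [G e] to be linear. *)
Lemma F_linear e : 0 < e -> linear (F e).
Proof.
move=> e0; have Ginj x y : shift e x = shift e y -> x = y.
  move=> exy; apply/eqP; rewrite -subr_eq0; apply/eqP/(sq_eq0 ip_norm)/le_anti.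
  rewrite sq_ge0 // andbT -(pmulr_rle0 _ (exprn_gt0 2 e0)).
  by apply: le_trans (shift_ge_sq _ e0) _; rewrite shiftB exy subrr sq0.
have Gl : linear (G e) by move=> a x y; apply: Ginj; rewrite shift_linear !shiftG.
move=> a x y; rewrite !FE // (linearP X) Gl (linearP X) scalerDr.
by rewrite addrACA.
Qed.

Lemma FB e x y : 0 < e -> F e (x - y) = F e x - F e y.
Proof. by move=> e0; rewrite addrC -scaleN1r F_linear // scaleN1r addrC. Qed.

Lemma FZ e a x : 0 < e -> F e (a *: x) = a *: F e x.
Proof.
move=> e0; have F0 : F e 0 = 0 by have := FB 0 0 e0; rewrite !subrr.
by rewrite -[a *: x]addr0 F_linear // F0 addr0.
Qed.

(** [inverse_antitone] for F_e <= F_d; the remainder dominates the squared distance because F_e >=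
    I. *)
Lemma K_dist d e g : 0 < d -> d <= e ->
  sq (K d g - K e g) <= rip g (K e g) - rip g (K d g).
Proof.
move=> d0 de; have e0 := lt_le_trans d0 de.
pose Fe : {linear H -> H} := HB.pack (F e)
  (GRing.isLinear.Build _ _ _ _ (F e) (F_linear e0)).
pose Fd : {linear H -> H} := HB.pack (F d)
  (GRing.isLinear.Build _ _ _ _ (F d) (F_linear d0)).
have := @inverse_antitone Fe Fd g (K e g) (K d g)
  (fun x y => F_sym x y e0) (fun u => F_le u d0 de) (FK g e0) (FK g d0).
exact/le_trans/F_ge.
Qed.

Lemma sqK_le e g : 0 < e -> sq (K e g) <= rip g (K e g).
Proof. by move=> e0; have := F_ge (K e g) e0; rewrite FK. Qed.

Lemma ripK_le e g : 0 < e -> rip g (K e g) <= sq g.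
Proof.
by move=> e0; have := sqK_le g e0; have := rip_le1 ip_norm g (K e g); lra.
Qed.

(** * Limits resting on the unboundedness of the forms of F_e *)

Section FormUnbounded.
Hypothesis F_unbounded : forall g M,
  (forall e, 0 < e -> rip (F e g) g <= M) -> X g = 0.

Lemma F_cvg_pinfty g M : X g != 0 ->
  exists2 e0, 0 < e0 & forall e, 0 < e -> e < e0 -> M <= rip (F e g) g.
Proof.
move=> Xg; have [e0 [e00 he0]] : exists e0, 0 < e0 /\ M < rip (F e0 g) g.
  apply: contrapT => h; move/eqP: Xg; apply; apply: (@F_unbounded g M) => e e0.
  by rewrite leNgt; apply/negP => lt; apply: h; exists e.
exists e0 => // e ep ee0.
exact: le_trans (ltW he0) (F_le _ ep (ltW ee0)).
Qed.

(* The net K e g is Cauchy because e |-> (K e g, g) is monotone, and its limit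
   k satisfies (F e k, k) <= |g|^2 for all e. *)
Lemma K_cvg0 g : (forall y, X y = 0 -> rip g y = 0) ->
  forall d, 0 < d -> exists2 e0, 0 < e0 & forall e, 0 < e -> e < e0 -> sq (K e g) < d.
Proof.
move=> gX.
pose E := [set rip g (K e g) | e in [set e | 0 < e]].
have Elb : has_inf E.
  split; first by exists (rip g (K 1 g)), 1 => //=.
  by exists 0 => _ [e /= e0 <-]; apply: le_trans (sqK_le _ e0); exact: sq_ge0.
pose m := inf E.
have mE e : 0 < e -> m <= rip g (K e g).
  by move=> e0; apply: ge_inf; [exact: Elb.2 | exists e].
have near0 (e0 : R) : 0 < e0 -> \forall e \near 0^'+, 0 < e /\ e < e0.
  move=> e00; near=> e; split; near: e; [exact: nbhs_right_gt|exact: nbhs_right_lt].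
have [k hk] : exists k, forall d : R, 0 < d -> \forall e \near 0^'+, sq (K e g - k) < d.
  apply: (cauchy_net ip_norm) => d d0.
  have [_ [e0 /= e00 <-] he0] := inf_adherent d0 Elb.
  exists e0; apply: filterS (near0 _ e00) => e [ep ee0].
  apply: le_lt_trans (K_dist _ ep (ltW ee0)) _.
  by have := mE _ ep; rewrite /m in he0 *; lra.
have weak u d : 0 < d -> \forall e \near 0^'+, `|rip u (K e g - k)| < d.
  move=> d0; have s1 : 0 < sq u + 1 by rewrite ltr_wpDl ?sq_ge0.
  have := hk (d ^+ 2 / (sq u + 1)); rewrite divr_gt0 ?exprn_gt0 // => /(_ isT).
  apply: filterS => e; rewrite ltr_pdivlMr // => he.
  rewrite -(ltr_pXn2r (_ : 0 < 2)%N) ?nnegrE ?(ltW d0) // real_normK ?num_real //.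
  apply: le_lt_trans (rip_CS ip_norm _ _) (le_lt_trans _ he).
  by rewrite mulrC ler_wpM2l ?sq_ge0 // lerDl.
have Xk : X k = 0.
  apply: (@F_unbounded k (sq g)) => e e0; apply/ler_addgt0Pr => d d0.
  have d2 : 0 < d / 2 by lra.
  have [f [[fp fe] hf]] := filter_ex (filterI (near0 _ e0) (weak (F e k) _ d2)).
  (* For f < e, F_e <= F_f and (F_f K_f g, K_f g) = (g, K_f g) <= |g|^2; since K_f g tends to k, the
     bound passes to (F_e k, k). *)
  have h1 : rip (F e (K f g)) (K f g) <= sq g.
    apply: le_trans (F_le _ fp (ltW fe)) _; rewrite FK //.
    by rewrite ripK_le.
  have := F_ge (K f g - k) e0; have := sq_ge0 ip_norm (K f g - k).
  move: hf; rewrite FB // ltr_norml !ripE (F_sym (K f g) k) // (ripC _ (K f g)); lra.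
have k0 : sq k = 0.
  have gk : rip g k = 0 by apply: gX.
  apply/le_anti; rewrite sq_ge0 // andbT; apply/ler_addgt0Pr => d d0.
  have [f [[fp _] hf]] := filter_ex (filterI (near0 _ ltr01) (weak k d d0)).
  (* As X k = 0, F_f fixes k, so (k, K_f g) = (k, F_f K_f g) = (k, g) = 0 by orthogonality of g to
     ker X. In the limit |k|^2 = 0. *)
  have Fk : F f k = k.
    by have := FZ 0 0 fp; rewrite !scale0r !FE // linear0 add0r Xk => ->; rewrite addr0.
  move: hf; rewrite ripDr ripNr -{1}Fk F_sym // FK // ripC gk sub0r normrN.
  by rewrite add0r => /ltW; apply: le_trans; exact: ler_norm.
move=> d d0; have [e0 /= e00 he0] := hk d d0.
exists e0 => // e ep ee0.
have -> : K e g = K e g - k by rewrite (sq_eq0 ip_norm k0) subr0.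
by apply: he0 => //=; rewrite sub0r normrN gtr0_norm.
Unshelve. all: by end_near. Qed.

End FormUnbounded.

(** Positivity of [shift e] at h - G_e X g gives 2 (X g, h) - (shift e h, h) <= (G_e X g, X g) <= M.
    The choice of [e] makes the extra term e |h|^2 at most d. *)
Lemma F_bounded_form g M : (forall e, 0 < e -> rip (F e g) g <= M) ->
  forall h, 2 * rip (X g) h - (sq h - rip (T h) h) <= M.
Proof.
move=> hM h; apply/ler_addgt0Pr => d d0.
have s1 : 0 < sq h + 1 by rewrite ltr_wpDl ?sq_ge0.
pose e := d / (sq h + 1); have e0 : 0 < e by rewrite divr_gt0.
have ed : e * sq h <= d.
  by rewrite /e mulrAC ler_pdivrMr // ler_wpM2l ?(ltW d0) // lerDl.
have := hM e e0; rewrite F_form //; have := sq_ge0 ip_norm g.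
have : 0 <= rip (shift e (h - G e (X g))) (h - G e (X g)).
  by apply: le_trans (shift_ge _ _); rewrite mulr_ge0 ?sq_ge0 // ltW.
have E1 : rip (shift e h) (G e (X g)) = rip (X g) h.
  by rewrite shift_sym shiftG // ripC.
move: E1 (shift_form e h); rewrite shiftB shiftG //.
move: (shift e h) (X g) => a v; rewrite !ripE => -> ->.
rewrite (ripC _ v (G e v)); lra.
Qed.

(** * Limits resting on the density of the range of I - T *)

Section DenseRange.
Hypothesis dense_ran : forall f d, 0 < d -> exists h, sq (f - (h - T h)) < d.
Variable c : R.
Hypothesis X_bound : forall u, sq (X u) <= c * sq u.

(** Approximate X g by (I - T) h with error r. Then [shift e] maps G_e X g - h to r - e h, so e |G_e
    X g - h| <= |r - e h|, which is small with r and e. *)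
Lemma scale_F_cvg0 g d : 0 < d ->
  exists2 e0, 0 < e0 & forall e, 0 < e -> e < e0 -> e ^+ 2 * sq (F e g) < d.
Proof.
move=> d0.
pose a := `|c| + 1; have a0 : 0 < a by rewrite ltr_wpDl.
have Xa u : sq (X u) <= a * sq u.
  apply: le_trans (X_bound u) _; rewrite ler_wpM2r ?sq_ge0 //.
  by apply: le_trans (ler_norm c) _; rewrite lerDl.
(* The final estimate is e^2 |F_e g|^2 <= 8 a |r|^2 + e^2 (2 |g|^2 + 12 a |h|^2); this choice keeps
   the first term below d / 2, and the one of [b] does so for the second. *)
have [|h hr] := @dense_ran (X g) (d / (16 * a)).
  by rewrite divr_gt0 ?mulr_gt0.
set r := X g - (h - T h) in hr.
pose b := 2 * sq g + 12 * a * sq h + 1.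
have b0 : 0 < b by rewrite ltr_wpDl // addr_ge0 // !mulr_ge0 ?sq_ge0 // ltW.
exists (Num.min 1 (d / (2 * b))); first by rewrite lt_min ltr01 divr_gt0 ?mulr_gt0.
move=> e e0; rewrite lt_min => /andP[e1 eb].
set u := G e (X g).
have hd : e ^+ 2 * sq (u - h) <= 2 * sq r + 2 * (e ^+ 2 * sq h).
  apply: le_trans (shift_ge_sq _ e0) _.
  have -> : shift e (u - h) = r - e%:C *: h.
    rewrite shiftB shiftG // /shift /r rmorphD /= scalerDl scale1r.
    by rewrite !opprD !opprK !addrA -!addrA; congr (_ + (_ + _)); rewrite addrC.
  by apply: le_trans (sqD_le ip_norm _ _) _; rewrite sqN sqZr.
have hu : e ^+ 2 * sq u <= 4 * sq r + 6 * (e ^+ 2 * sq h).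
  have := sqD_le ip_norm (u - h) h; rewrite subrK => h1.
  have : e ^+ 2 * sq u <= e ^+ 2 * (2 * sq (u - h) + 2 * sq h).
    by rewrite ler_pM2l ?exprn_gt0.
  lra.
have hF : sq (F e g) <= 2 * sq g + 2 * (a * sq u).
  rewrite FE //; apply: le_trans (sqD_le ip_norm _ _) _.
  by rewrite lerD2l ler_pM2l.
have hF2 : e ^+ 2 * sq (F e g) <= e ^+ 2 * (2 * sq g) + 2 * (a * (e ^+ 2 * sq u)).
  apply: le_trans (_ : e ^+ 2 * (2 * sq g + 2 * (a * sq u)) <= _).
    by rewrite ler_pM2l ?exprn_gt0.
  by rewrite le_eqVlt; apply/orP; left; apply/eqP; ring.
have hF3 : a * (e ^+ 2 * sq u) <= a * (4 * sq r + 6 * (e ^+ 2 * sq h)).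
  by rewrite ler_pM2l.
have hr2 : a * sq r < d / 16.
  by move: hr; rewrite ltr_pdivlMr ?mulr_gt0 //; lra.
have he2 : e ^+ 2 * b < d / 2.
  move: eb; rewrite ltr_pdivlMr ?mulr_gt0 // => eb.
  have : e ^+ 2 * b <= e * b by rewrite ler_pM2r // expr2 ger_pMl // ltW.
  lra.
have e2 : 0 < e ^+ 2 by rewrite exprn_gt0.
by rewrite /b in he2; lra.
Qed.

(** The variational formula for F_e^-1 is tested at the vector t e g: (K_e g, g) >= 2 t e |g|^2 -
    t^2 e^2 (F_e g, g), where e (F_e g, g) tends to 0 by [scale_F_cvg0]. *)
Lemma K_div_cvg_pinfty g M : g != 0 ->
  exists2 e0, 0 < e0 & forall e, 0 < e -> e < e0 -> M * e <= rip (K e g) g.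
Proof.
move=> g0; have s0 := sq_gt0 ip_norm g0.
pose M' := `|M| + 1; have M0 : 0 < M' by rewrite ltr_wpDl.
(* With this [t] the first term is 2 e M'; once e (F_e g, g) <= z = M' / t^2, the second is at most
   e M'. *)
pose t := M' / sq g; have t0 : 0 < t by rewrite divr_gt0.
pose z := M' / t ^+ 2; have z0 : 0 < z by rewrite divr_gt0 ?exprn_gt0.
have [|e0 e00 he0] := @scale_F_cvg0 g (z ^+ 2 / sq g).
  by rewrite divr_gt0 ?exprn_gt0.
exists e0 => // e ep ee0; have := he0 e ep ee0.
rewrite ltr_pdivlMr // => h1.
have h2 : e * rip (F e g) g <= z.
  rewrite -(ler_pXn2r (_ : 0 < 2)%N) ?nnegrE ?(ltW z0) //; last first.
    by rewrite mulr_ge0 ?(ltW ep) //; apply: le_trans (F_ge _ ep); exact: sq_ge0.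
  apply: le_trans (ltW h1); rewrite exprMn -(mulrA _ (sq _)) ler_pM2l ?exprn_gt0 //.
  exact: rip_CS.
have h3 : t ^+ 2 * (e * rip (F e g) g) <= M'.
  apply: le_trans (_ : t ^+ 2 * z <= _); first by rewrite ler_pM2l ?exprn_gt0.
  by rewrite /z mulrC divfK // gt_eqF ?exprn_gt0.
have h4 : t * sq g = M' by rewrite /t divfK // gt_eqF.
have h5 : 2 * (t * e) * sq g - (t * e) ^+ 2 * rip (F e g) g <= rip (K e g) g.
  have := F_ge ((t * e)%:C *: g - K e g) ep.
  have -> : F e ((t * e)%:C *: g - K e g) = (t * e)%:C *: F e g - g.
    by rewrite FB // FZ // FK.
  move=> /(le_trans (sq_ge0 ip_norm _)); rewrite !ripE (F_sym g (K e g)) // FK // -/(sq g).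
  rewrite (ripC _ g (K e g)); lra.
apply: le_trans h5.
have : e * (t ^+ 2 * (e * rip (F e g) g)) <= e * M' by rewrite ler_pM2l.
have : M * e <= M' * e by rewrite ler_pM2r // /M'; have := ler_norm M; lra.
have -> : 2 * (t * e) * sq g = 2 * e * M' by rewrite -h4; ring.
lra.
Qed.

End DenseRange.
End Core.

(** * Extremality of selfadjoint contractive extensions *)

Section SelfadjointExtensions.
Context {R : realType} {H : completeNormedModType R[i]}.
Variable ip : {dot H for @Num.conj R[i]}.
Hypothesis ip_norm : hilbert_dot ip.
Local Notation rip := (rip ip).
Local Notation sq := (sq ip).

(** The imaginary part of (x, y) is minus the real part of (i x, y), and [A] commutes with i. *)
Lemma rip_sym_ip (A : {linear H -> H}) :
  (forall x y, rip (A x) y = rip x (A y)) -> forall x y, ip (A x) y = ip x (A y).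
Proof.
move=> As x y; apply/eqP; rewrite eq_complex !Im_rip -/(rip (A x) y) As eqxx /=.
by rewrite -(linearZ_LR A) As.
Qed.

(** Polarization at h + A h and h - A h: 4 |A h|^2 <= 2 |h|^2 + 2 |A h|^2. *)
Lemma symmetric_contraction (A : {linear H -> H}) :
  (forall x y, rip (A x) y = rip x (A y)) ->
  (forall h, `|rip (A h) h| <= sq h) -> forall h, sq (A h) <= sq h.
Proof.
move=> As Ah h; have := Ah (h + A h); have := Ah (h - A h).
rewrite !ler_norml (linearB A) (linearD A) /sq !ripE (As (A h) h).
rewrite (ripC _ h (A h)); lra.
Qed.

Definition rank_one (c : R) (v h : H) : H := (c%:C * ip h v) *: v.

Lemma rank_one_linear c v : linear (rank_one c v).
Proof.
move=> a x y; rewrite /rank_one ipDl ipZl mulrDr scalerDl scalerA.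
by congr (_ *: _ + _); ring.
Qed.
HB.instance Definition _ c v :=
  GRing.isLinear.Build _ _ _ _ (rank_one c v) (rank_one_linear c v).

Lemma rank_one_sym c v x y : rip (rank_one c v x) y = rip x (rank_one c v y).
Proof.
rewrite /rip /rank_one. rewrite ipZl ipZr (ipC ip v y).
by rewrite !ReM; case: (ip x v) => a b; case: (ip y v) => a' b' /=; ring.
Qed.

Lemma rank_one_form c v h :
  rip (rank_one c v h) h = c * (complex.Re (ip h v) ^+ 2 + complex.Im (ip h v) ^+ 2).
Proof.
rewrite /rip /rank_one ipZl (ipC ip v h) !ReM.
by case: (ip h v) => a b /=; ring.
Qed.

(* The rank one operator M^-1 (., v) v is at most I - T, so T + M^-1 (., v) v is
   another contractive extension of the restriction of T to D; it is dominated
   by the largest one, T', hence M^-1 (., v) v is at most T' - T = Y^2. *)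
Lemma dominated_vector_range (D : set H) (T T' Y : {linear H -> H}) (v : H) (M : R) :
  (forall x y, rip (T x) y = rip x (T y)) ->
  (forall h, `|rip (T h) h| <= sq h) ->
  (forall x y, rip (Y x) y = rip x (Y y)) ->
  (forall h, Y (Y h) = T' h - T h) ->
  (forall y, D y -> ip y v = 0) ->
  (forall A : {linear H -> H}, (forall x y, rip (A x) y = rip x (A y)) ->
     (forall h, sq (A h) <= sq h) -> (forall y, D y -> A y = T y) ->
     forall h, rip (A h) h <= rip (T' h) h) ->
  (forall h, 2 * rip v h - (sq h - rip (T h) h) <= M) ->
  exists w, v = Y w.
Proof.
move=> Ts Tle Ys YY Dv T'max hM.
have M0 : 0 <= M by have := hM 0; rewrite !rip0r sq0; lra.
pose M' := M + 1; have M'0 : 0 < M' by rewrite /M'; lra.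
pose n h := complex.Re (ip h v) ^+ 2 + complex.Im (ip h v) ^+ 2.
have n0 h : 0 <= n h by rewrite addr_ge0 ?sqr_ge0.
have hn h : n h <= M' * (sq h - rip (T h) h).
  have a0 : 0 <= sq h - rip (T h) h by have := Tle h; rewrite ler_norml; lra.
  set a := sq h - _ in a0 *.
  (* Testing at the multiple s (v, h) h absorbs the phase of (v, h), so the full modulus [n h]
     appears instead of a real part. *)
  have quad (s : R) : 2 * s * n h - s ^+ 2 * n h * a <= M.
    have := hM ((s%:C * ip v h) *: h).
    have -> : rip v ((s%:C * ip v h) *: h) = s * n h.
      rewrite /rip ipZr /n (ipC ip h v) ReM.
      by case: (ip v h) => x y /=; ring.
    rewrite (linearZ_LR T) sqZ //.
    have -> : rip ((s%:C * ip v h) *: T h) ((s%:C * ip v h) *: h) =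
        s ^+ 2 * n h * rip (T h) h.
      have Tr : ip (T h) h = (rip (T h) h)%:C.
        apply/eqP; rewrite eq_complex /= eqxx /=.
        have := ImipC ip (T h) h; rewrite -(rip_sym_ip Ts h h) => e.
        by apply/eqP; lra.
      rewrite {1}/rip ipZl ipZr Tr /n (ipC ip h v).
      by case: (ip v h) => x y /=; ring.
    rewrite /a /n (ipC ip h v); case: (ip v h) => x y /=; lra.
  (* If a = 0, a nonzero [n h] would give 2 M' <= M. Otherwise s = 1 / a is the optimal choice and
     gives n h <= M a. *)
  have [a00|a00] := eqVneq a 0.
    have := quad (M' / n h); rewrite a00 !mulr0 subr0.
    have [->//|nn0] := eqVneq (n h) 0.
    by rewrite -mulrA divfK // /M'; lra.
  have ap : 0 < a by rewrite lt_neqAle eq_sym a00.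
  have := quad a^-1.
  have -> : 2 * a^-1 * n h - a^-1 ^+ 2 * n h * a = n h / a by field.
  rewrite ler_pdivrMr // => h1; apply: le_trans h1 _.
  by rewrite ler_pM2r // /M' lerDl.
pose A : {linear H -> H} := GRing.add_fun T (rank_one M'^-1 v).
have AE h : A h = T h + rank_one M'^-1 v h by [].
have Af h : rip (A h) h = rip (T h) h + M'^-1 * n h.
  by rewrite AE ripDl rank_one_form.
have As x y : rip (A x) y = rip x (A y).
  by rewrite !AE !ripE Ts rank_one_sym.
have AT' h : rip (A h) h <= rip (T' h) h.
  apply: T'max => // [u|y Dy]; last first.
    by rewrite AE /rank_one Dv // mulr0 scale0r addr0.
  apply: (symmetric_contraction As) => {}u.
  rewrite Af; have := Tle u; rewrite !ler_norml => /andP[h1 h2].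
  have := hn u; rewrite -ler_pdivrMl // => h3.
  have h4 : 0 <= M'^-1 * n u by rewrite mulr_ge0 // invr_ge0 ltW.
  by apply/andP; split; lra.
apply: (range_adjoint ip_norm Ys (ltW M'0)) => h.
apply: (@le_trans _ _ (n h)); first by rewrite /n lerDl sqr_ge0.
rewrite -ler_pdivrMl //.
have -> : sq (Y h) = rip (T' h) h - rip (T h) h.
  by rewrite /sq Ys YY !ripE ![rip h _]ripC.
by have := AT' h; rewrite Af; lra.
Qed.

End SelfadjointExtensions.

(** * Resolvents and the functions Q *)

Section Resolvent.
Context {R : realType} {H : completeNormedModType R[i]}.
Variable ip : {dot H for @Num.conj R[i]}.
Hypothesis ip_norm : hilbert_dot ip.
Local Notation rip := (rip ip).
Local Notation sq := (sq ip).

Variable b : {linear H -> H}.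
Hypothesis b_sym : forall x y, ip (b x) y = ip x (b y).
Hypothesis b_le : forall h, sq (b h) <= sq h.

Lemma contraction_form h : `|rip (b h) h| <= sq h.
Proof.
have := b_le h; have := rip_le1 ip_norm (b h) h; have := rip_le1 ip_norm (- b h) h.
by rewrite sqN ripNl ler_norml; lra.
Qed.

(* With S = (I - b) (I + b)^-1 one has (S - l) (h + b h) = pencil l h, so the
   operator I + (l + 1) (S - l)^-1 is twice the inverse of pencil l. *)
Definition pencil (l : R[i]) (h : H) : H := (1 - l) *: h - (1 + l) *: b h.

Lemma pencil_linear l : linear (pencil l).
Proof.
move=> a x y; rewrite /pencil (linearP b) !scalerDr opprD addrACA.
by congr (_ + _); rewrite scalerN !scalerA !(mulrC a).
Qed.
HB.instance Definition _ l :=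
  GRing.isLinear.Build _ _ _ _ (pencil l) (pencil_linear l).

Lemma pencil_adj l x y : ip (pencil l x) y = ip x (pencil (Num.conj l) y).
Proof.
rewrite /pencil -!scaleNr ipDl ipDr !ipZl !ipZr b_sym.
by congr (_ * _ + _ * _); case: l => p q; apply/eqP; rewrite eq_complex /=;
  apply/andP; split; apply/eqP; ring.
Qed.

(** The factor 1 + i y rotates the segment [-2 l, 2] into a right half-plane: its endpoints get real
    parts 2 u and 2. *)
Lemma pencil_form (y : R) l h (u := y * complex.Im l - complex.Re l) :
  rip ((1 +i* y) *: pencil l h) h = (1 + u) * sq h - (1 - u) * rip (b h) h.
Proof.
have br : ip (b h) h = (rip (b h) h)%:C.
  apply/eqP; rewrite eq_complex /= eqxx /=.
  by have := ImipC ip (b h) h; rewrite -(b_sym h h) => e; apply/eqP; lra.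
rewrite {1}/rip /pencil -(scaleNr (1 + l)) !ipZl ipDl !ipZl br ip_sq /u.
by case: l {u} => p q /=; ring.
Qed.

(** As k <= min (1, u), the rotated numerical range has real part at least 2 k; dividing by |1 + i
    y| and squaring gives the constant. *)
Lemma pencil_lower (y k : R) l h :
  0 < k -> k <= 1 -> k <= y * complex.Im l - complex.Re l ->
  4 * k ^+ 2 / (1 + y ^+ 2) * sq h <= sq (pencil l h).
Proof.
move=> k0 k1 ku; have y1 : 0 < 1 + y ^+ 2 by rewrite ltr_wpDr ?sqr_ge0.
rewrite mulrAC ler_pdivrMr // mulrC.
have [->|h0] := eqVneq h 0; first by rewrite sq0 mul0r mulr_ge0 ?sq_ge0 // ltW.
have n0 := sq_gt0 ip_norm h0.
rewrite -(ler_pM2r n0); have := rip_CS ip_norm ((1 +i* y) *: pencil l h) h.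
rewrite sqZ //= expr1n [_ * (1 + _)]mulrC; apply: le_trans.
rewrite (_ : sq h * (4 * k ^+ 2) * sq h = (2 * k * sq h) ^+ 2); last by ring.
have h1 : 2 * k * sq h <= rip ((1 +i* y) *: pencil l h) h.
  rewrite pencil_form; have := contraction_form h; rewrite ler_norml => /andP[l1 l2].
  set u := _ - _ in ku *; set n := sq h in n0 l1 l2 *; set t := rip _ _ in l1 l2 *.
  have p1 : 0 <= (u - k) * (n + t) by rewrite mulr_ge0 //; lra.
  have p2 : 0 <= (1 - k) * (n - t) by rewrite mulr_ge0 //; lra.
  lra.
have h2 : 0 <= 2 * k * sq h by rewrite !mulr_ge0 // ltW.
by rewrite ler_pXn2r ?nnegrE // (le_trans h2).
Qed.

End Resolvent.

(** The slit plane is a union of open half-planes avoiding R_+. For non-real l the chosen [y] makes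
    the expression equal to 1; for real negative l, y = 0. *)
Lemma slit_planeP (R : realType) (l : R[i]) :
  slit_plane l <-> exists y : R, 0 < y * complex.Im l - complex.Re l.
Proof.
split=> [sl|[y hy] [t /= t0 tl]]; last by move: hy; rewrite -tl /=; lra.
have [i0|i0] := eqVneq (complex.Im l) 0; last first.
  exists ((complex.Re l + 1) / complex.Im l); rewrite divfK //; lra.
exists 0; rewrite mul0r sub0r oppr_gt0 ltNge; apply/negP => a0; apply: sl.
by exists (complex.Re l) => //; case: l i0 {a0} => p q /= ->.
Qed.

Lemma slit_plane_conj (R : realType) (l : R[i]) :
  slit_plane l -> slit_plane (Num.conj l).
Proof.
move=> /slit_planeP[y hy]; apply/slit_planeP; exists (- y).
by case: l hy => p q /=; rewrite mulrNN.
Qed.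

Section ResolventExists.
Context {R : realType} {H : completeNormedModType R[i]}.
Variable ip : {dot H for @Num.conj R[i]}.
Hypothesis ip_norm : hilbert_dot ip.
Local Notation rip := (rip ip).
Local Notation sq := (sq ip).

Lemma resolvent_exists (b : {linear H -> H}) :
  (forall x y, ip (b x) y = ip x (b y)) -> (forall h, sq (b h) <= sq h) ->
  exists r : R[i] -> {linear H -> H}, forall l, slit_plane l ->
    cancel (r l) (pencil b l) /\ cancel (pencil b l) (r l).
Proof.
move=> bs ble; suff : forall l, exists r : {linear H -> H}, slit_plane l ->
    cancel r (pencil b l) /\ cancel (pencil b l) r.
  by move=> /choice[r hr]; exists r.
move=> l; have [sl|sl] := pselect (slit_plane l); last by exists idfun.
have /slit_planeP[y hy] := sl.
pose u := y * complex.Im l - complex.Re l.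
pose k := Num.min 1 u; have k0 : 0 < k by rewrite lt_min ltr01.
have k1 : k <= 1 by rewrite ge_min lexx.
have ku : k <= u by rewrite ge_min lexx orbT.
have y1 : 0 < 1 + y ^+ 2 by rewrite ltr_wpDr ?sqr_ge0.
have [||h|h|r hr] := @bounded_below_inv _ _ _ ip_norm (pencil b l)
  (pencil b (Num.conj l)) (4 * k ^+ 2 / (1 + y ^+ 2)).
- by move=> x z; rewrite /rip pencil_adj.
- by rewrite divr_gt0 // mulr_gt0 ?exprn_gt0.
- exact: (pencil_lower ip_norm bs ble).
- have := @pencil_lower _ _ _ ip_norm _ bs ble (- y) k (Num.conj l) h k0 k1.
  rewrite sqrrN; apply; apply: le_trans ku _; rewrite /u.
  by case: (l) => p q /=; rewrite mulrNN.
- by exists r.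
Qed.

End ResolventExists.

(** * The functions Q: bounds, imaginary part and derivative in l *)

Section QFunction.
Context {R : realType} {H : completeNormedModType R[i]}.
Variable ip : {dot H for @Num.conj R[i]}.
Hypothesis ip_norm : hilbert_dot ip.
Local Notation rip := (rip ip).
Local Notation sq := (sq ip).

Variables b X : {linear H -> H}.
Hypothesis b_sym : forall x y, ip (b x) y = ip x (b y).
Hypothesis b_le : forall h, sq (b h) <= sq h.
Hypothesis X_sym : forall x y, ip (X x) y = ip x (X y).
Variable c : R.
Hypothesis X_bound : forall u, sq (X u) <= c * sq u.
Hypothesis c_ge0 : 0 <= c.
Variable r : R[i] -> {linear H -> H}.
Hypothesis rP : forall l, slit_plane l ->
  cancel (r l) (pencil b l) /\ cancel (pencil b l) (r l).

(** The factor 1/2 of [Q_fun] is gone, as I + (l + 1) (S - l)^-1 is twice the inverse of the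
    pencil. *)
Definition qfun (s l : R[i]) (g : H) : H := s *: g + (l + 1) *: X (r l (X g)).

Lemma qfun_linear s l : linear (qfun s l).
Proof.
move=> a x y; rewrite /qfun !(linearP X) (linearP (r l)) (linearP X) !scalerDr.
rewrite addrACA; congr (_ + _ + _); rewrite !scalerA; first by rewrite mulrC.
by rewrite mulrC.
Qed.

Lemma qfunN s l g : qfun s l (- g) = - qfun s l g.
Proof. by rewrite /qfun (linearN X) (linearN (r l)) (linearN X) !scalerN opprD. Qed.

Lemma resolvent_adj l x y : slit_plane l -> ip (r l x) y = ip x (r (Num.conj l) y).
Proof.
move=> sl; have [rK _] := rP (slit_plane_conj sl); have [rK' _] := rP sl.
by rewrite -{1}(rK y) -[in RHS](rK' x) pencil_adj.
Qed.

Lemma qfun_adj s l x y : slit_plane l ->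
  ip (qfun s l x) y = ip x (qfun (Num.conj s) (Num.conj l) y).
Proof.
move=> sl; rewrite /qfun ipDl ipDr !ipZl !ipZr X_sym resolvent_adj // X_sym.

by congr (_ * _ + _ * _); [case: s | case: l {sl}] => p q; apply/eqP; rewrite eq_complex /=;
  apply/andP; split; apply/eqP; ring.
Qed.

(* The numerical range of the pencil stays away from 0 near l. *)
Lemma resolvent_bound l : slit_plane l ->
  exists C d : R, [/\ 0 < C, 0 < d & forall m, `|m - l| < d%:C ->
     slit_plane m /\ forall g, sq (r m g) <= C * sq g].
Proof.
move=> /slit_planeP[y hy]; pose u := y * complex.Im l - complex.Re l.
pose k := Num.min 1 (u / 2); have k0 : 0 < k by rewrite lt_min ltr01 divr_gt0.
have k1 : k <= 1 by rewrite ge_min lexx.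
have ku : k <= u / 2 by rewrite ge_min lexx orbT.
have y1 : 0 < 1 + y ^+ 2 by rewrite ltr_wpDr ?sqr_ge0.
have c0 : 0 < 4 * k ^+ 2 / (1 + y ^+ 2) by rewrite divr_gt0 // mulr_gt0 ?exprn_gt0.
have z0 : 0 < `|y| + 1 by rewrite ltr_wpDl.
(* Moving from l to m changes y Im l - Re l by at most (|y| + 1) |m - l|, so half of [u] survives in
   the disc. *)
exists (4 * k ^+ 2 / (1 + y ^+ 2))^-1, (u / 2 / (`|y| + 1)).
split; [by rewrite invr_gt0 | by rewrite !divr_gt0 |] => m ml.
have hm : k <= y * complex.Im m - complex.Re m.
  apply: le_trans ku _.
  have := ml; rewrite normc_def ltcR => ml1.
  have aux (p q : R) : `|p| <= Num.sqrt (p ^+ 2 + q ^+ 2).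
    by rewrite -sqrtr_sqr ler_wsqrtr // lerDl sqr_ge0.
  have re : `|complex.Re m - complex.Re l| < u / 2 / (`|y| + 1).
    by apply: le_lt_trans ml1; case: (m) (l) => ? ? [? ?] /=.
  have im : `|complex.Im m - complex.Im l| < u / 2 / (`|y| + 1).
    apply: le_lt_trans ml1; rewrite [X in _ <= Num.sqrt X]addrC.
    by case: (m) (l) => ? ? [? ?] /=.
  have h1 : `|y * (complex.Im m - complex.Im l)| + `|complex.Re m - complex.Re l| <= u / 2.
    rewrite normrM -[leRHS](divfK (lt0r_neq0 z0)) mulrDr mulr1 mulrC.
    by apply: lerD; rewrite ?ler_wpM2r // ltW.
  have := ler_norm (- (y * (complex.Im m - complex.Im l))).
  have := ler_norm (complex.Re m - complex.Re l); rewrite normrN /u in h1 *; lra.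
have sm : slit_plane m by apply/slit_planeP; exists y; apply: lt_le_trans k0 hm.
split=> // g; have [rK _] := rP sm.
by rewrite ler_pdivlMl // -{2}(rK g); apply: (pencil_lower ip_norm b_sym b_le).
Qed.

Lemma qfun_bound s l : slit_plane l ->
  exists2 C, 0 <= C & forall g, sq (qfun s l g) <= C * sq g.
Proof.
move=> sl; have [C [d [C0 d0 hC]]] := resolvent_bound sl.
have [_ {}hC] := hC l ltac:(by rewrite subrr normr0 ltcR).
pose ns (z : R[i]) := complex.Re z ^+ 2 + complex.Im z ^+ 2.
have ns0 z : 0 <= ns z by rewrite addr_ge0 ?sqr_ge0.
exists (2 * ns s + 2 * (ns (l + 1) * (c * (C * c)))).
  by rewrite addr_ge0 ?mulr_ge0 // ltW.
move=> g; apply: le_trans (sqD_le ip_norm _ _) _.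
rewrite !sqZ // -/(ns s) -/(ns (l + 1)).
have h : sq (X (r l (X g))) <= c * (C * (c * sq g)).
  apply: le_trans (X_bound _) _; rewrite ler_wpM2l //.
  by apply: le_trans (hC _) _; rewrite ler_wpM2l // ltW.
have := ler_wpM2l (ns0 (l + 1)) h; lra.
Qed.

(** With f the resolvent at X g, (X f, g) = (f, pencil l f), and the quantity equals 2 (Im l)^2
    |f|^2 because (b f, f) is real. *)
Lemma qfun_im (s : R) l g : slit_plane l ->
  0 <= complex.Im l * complex.Im (ip (qfun s%:C l g) g).
Proof.
move=> sl; have [rK _] := rP sl; set f := r l (X g).
have fE : pencil b l f = X g by rewrite /f rK.
have bf : ip f (b f) = (rip (b f) f)%:C.
  apply/eqP; rewrite eq_complex -b_sym /= eqxx /=; apply/eqP.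
  by have := ImipC ip (b f) f; rewrite -b_sym; lra.
rewrite /qfun ipDl !ipZl X_sym -/f -fE /pencil -(scaleNr (1 + l)) ipDr !ipZr bf !ip_sq //.
have -> : complex.Im (s%:C * (sq g)%:C + (l + 1) *
    (Num.conj (1 - l) * (sq f)%:C + Num.conj (- (1 + l)) * (rip (b f) f)%:C)) =
    2 * complex.Im l * sq f.
  by case: (l) => p q /=; ring.
have := sq_ge0 ip_norm f; have := sqr_ge0 (complex.Im l) => p1 p2.
have := mulr_ge0 p1 p2; lra.
Qed.

(** The derivative of [qfun] in l: the pencil has derivative - (I + b), so its inverse r has
    derivative r (I + b) r. *)
Definition qfun' (l : R[i]) (g : H) : H :=
  X (r l (X g)) + (l + 1) *: X (r l (r l (X g) + b (r l (X g)))).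

Lemma qfun'_linear l : linear (qfun' l).
Proof.
move=> a x y; rewrite /qfun' !(linearP X) !(linearP (r l)) !(linearP b).
rewrite addrACA -scalerDr (linearP (r l)) !(linearP X) !scalerDr !scalerA addrACA.
by rewrite (mulrC a).
Qed.

Lemma qfun'_bound l : slit_plane l ->
  exists2 C, 0 <= C & forall g, sq (qfun' l g) <= C * sq g.
Proof.
move=> sl; have [C [d [/ltW C0 d0 hC]]] := resolvent_bound sl.
have [_ {}hC] := hC l ltac:(by rewrite subrr normr0 ltcR).
pose z := complex.Re (l + 1) ^+ 2 + complex.Im (l + 1) ^+ 2.
have z0 : 0 <= z by rewrite addr_ge0 ?sqr_ge0.
have XrE v : sq (X (r l v)) <= c * C * sq v.
  by apply: le_trans (X_bound _) _; rewrite -(mulrA c) ler_wpM2l.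
exists (2 * (c * C * c) + 2 * (z * (c * C * (4 * (C * c))))).
  by do !(by [] || apply: mulr_ge0 || apply: addr_ge0).
move=> g; apply: le_trans (sqD_le ip_norm _ _) _; rewrite sqZ // -/z.
set u := r l (X g).
have h1 := XrE (X g); have h2 := XrE (u + b u).
have h3 : sq (u + b u) <= 4 * sq u.
  by apply: le_trans (sqD_le ip_norm _ _) _; have := b_le u; lra.
have h4 := hC (X g); have h5 := X_bound g.
have cC : 0 <= c * C by rewrite mulr_ge0.
have := ler_wpM2l cC h5; have := ler_wpM2l C0 h5; rewrite -/u in h1 h4 => h6 h7.
have h8 : sq (X (r l (u + b u))) <= c * C * (4 * (C * c)) * sq g.
  apply: le_trans h2 _; rewrite -(mulrA (c * C)) ler_wpM2l //; lra.
have := ler_wpM2l z0 h8; lra.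
Qed.

(** Two uses of the resolvent identity r_m - r_l = (m - l) r_m (I + b) r_l leave the remainder (m -
    l) X r_m (w g), bounded uniformly for m near l. *)
Lemma qfun_derive s l : slit_plane l ->
  exists C d : R, [/\ 0 <= C, 0 < d & forall m, m != l -> `|m - l| < d%:C ->
    slit_plane m /\
    forall g, sq ((m - l)^-1 *: (qfun s m g - qfun s l g) - qfun' l g) <=
      (complex.Re (m - l) ^+ 2 + complex.Im (m - l) ^+ 2) * (C * sq g)].
Proof.
move=> sl; have [C [d [C0 d0 hC]]] := resolvent_bound sl.
have [_ hl] := hC l ltac:(by rewrite subrr normr0 ltcR).
have [rKl rKl'] := rP sl.
pose E u := u + b u.
have EB u : sq (E u) <= 4 * sq u.
  by apply: le_trans (sqD_le ip_norm _ _) _; have := b_le u; lra.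
pose z := complex.Re (l + 1) ^+ 2 + complex.Im (l + 1) ^+ 2.
have z0 : 0 <= z by rewrite addr_ge0 ?sqr_ge0.
pose w g := let e := E (r l (X g)) in e + (l + 1) *: E (r l e).
exists (c * (C * ((2 + 2 * z * (4 * C)) * (4 * (C * c))))), d.
have Cge0 := ltW C0.
split=> [|//|m ml md]; first by do !(by [] || apply: mulr_ge0 || apply: addr_ge0).
have [sm hm] := hC m md; have [rKm rKm'] := rP sm; split=> // g.
have ml0 : m - l != 0 by rewrite subr_eq0.
have res v : r m v - r l v = (m - l) *: r m (E (r l v)).
  rewrite -(linearZ_LR (r m)) -{1}(rKl v) -(rKm' (r l v)) -(linearB (r m)) rKm'.
  congr (r m _); rewrite /pencil /E.
  by apply: (ip_eq ip_norm) => x; rewrite !(ipDl, ipNl, ipZl); ring.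
have -> : (m - l)^-1 *: (qfun s m g - qfun s l g) - qfun' l g =
    (m - l) *: X (r m (w g)).
  set v := X g; set e := E (r l v).
  have h1 : X (r m v) = X (r l v) + (m - l) *: X (r m e).
    by rewrite -(linearZ_LR X) -res (linearB X) addrC subrK.
  have h2 : X (r l e) = X (r m e) - (m - l) *: X (r m (E (r l e))).
    by rewrite -(linearZ_LR X) -res (linearB X) opprB addrC subrK.
  rewrite /qfun /qfun' /w -/v -/e -/(E (r l v)) -/e (linearD (r m)) (linearZ_LR (r m)).
  rewrite (linearD X) (linearZ_LR X) h1 h2.
  by apply: (ip_eq ip_norm) => x; rewrite !(ipDl, ipNl, ipZl); field.
rewrite sqZ // ler_wpM2l ?addr_ge0 ?sqr_ge0 //.
apply: le_trans (X_bound _) _; rewrite -!mulrA ler_wpM2l //.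
apply: le_trans (hm _) _; rewrite ler_wpM2l //.
have hw e : sq (e + (l + 1) *: E (r l e)) <= (2 + 2 * z * (4 * C)) * sq e.
  have := sqD_le ip_norm e ((l + 1) *: E (r l e)); rewrite sqZ // -/z.
  have := ler_wpM2l z0 (EB (r l e)); have := ler_wpM2l z0 (hl e); lra.
apply: le_trans (hw _) _; rewrite -!mulrA ler_wpM2l ?addr_ge0 ?mulr_ge0 //.
apply: le_trans (EB _) _; rewrite ler_pM2l //.
apply: le_trans (hl _) _; rewrite ler_wpM2l //.
Qed.

End QFunction.

(** * Graphs of everywhere defined operators *)

Section GraphsOfMaps.
Context {R : realType} {H : completeNormedModType R[i]}.
Variable ip : {dot H for @Num.conj R[i]}.
Hypothesis ip_norm : hilbert_dot ip.
Local Notation rip := (rip ip).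
Local Notation sq := (sq ip).

Definition gr (f : H -> H) : graph H := fun p => p.2 = f p.1.
Arguments gr f p /.

Lemma bounded_op_gr (A : graph H) : bounded_op setT A ->
  exists f : {linear H -> H}, A = gr f /\
    exists2 c, 0 <= c & forall x, sq (f x) <= c * sq x.
Proof.
case=> [[[_ Alin] Afun] Adom _ [c hc]].
have Aex x : exists y, A (x, y) by have : op_dom A x by rewrite Adom.
have [f fP] := choice Aex.
have fl : linear f by move=> a x y; apply: (Afun (a *: x + y)) => //; apply: Alin.
pose f' : {linear H -> H} := HB.pack f (GRing.isLinear.Build _ _ _ _ f fl).
exists f'; split.
  apply/seteqP; split=> [[x y] /= Axy|[x y] /= ->]; last exact: fP.
  exact: Afun Axy (fP x).
exists (`|c| ^+ 2) => [|x]; first exact: exprn_ge0.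
rewrite -(norm_le_sq ip_norm) //; apply: le_trans (hc x _ (fP x)) _.
by rewrite ler_wpM2r // lecR ler_norm.
Qed.

Lemma op_sub_gr f g : op_sub (gr f) (gr g) = gr (fun x => f x - g x).
Proof.
apply/seteqP; split=> [[x y] [y1 [y2 [h1 [y3 h2 h3] h4]]]|[x y] /= ->].
  by move: h1 h2 h3 h4 => /= -> -> -> ->; rewrite scaleN1r.
by exists (f x), (- g x); split=> //; exists (g x) => //=; rewrite scaleN1r.
Qed.

Lemma selfadjoint_gr (f : H -> H) :
  (gr f = op_adj ip setT (gr f)) <-> (forall x y, ip (f x) y = ip x (f y)).
Proof.
split=> [e x y|fs].
  have : gr f (y, f y) by [].
  by rewrite e => -[_ _]; apply.
apply/seteqP; split=> [[x y] /= ->|[x y] /= [_ _ h]].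
  by split=> // u v /= ->; exact: fs.
apply: (ip_eq ip_norm) => z.
by rewrite fs (ipC ip y) (ipC ip x) -(h z (f z) erefl).
Qed.

Lemma sc_extension_gr (B : graph H) (f : {linear H -> H}) :
  (forall x y, ip (f x) y = ip x (f y)) -> (forall h, sq (f h) <= sq h) ->
  (forall x y, B (x, y) -> y = f x) -> sc_extension ip B (gr f).
Proof.
move=> fs fc Bf; split; last by move=> [x y] /Bf.
- split.
  + split=> [|x y z /= -> -> //]; split=> [/=|a x y z t /= -> ->].
      by rewrite (linear0 f).
    by rewrite (linearP f).
  + by apply/seteqP; split=> // x _; exists (f x).
  + by [].
  + by exists 1 => x y /= ->; rewrite (norm_le_sq ip_norm) // expr1n mul1r.
- exact/selfadjoint_gr.
- by move=> x y /= ->; rewrite (contractive_sq ip_norm).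
Qed.

Lemma sc_extensionP (B A : graph H) : sc_extension ip B A ->
  exists f : {linear H -> H}, [/\ A = gr f, forall x y, ip (f x) y = ip x (f y),
    forall h, sq (f h) <= sq h & forall x y, B (x, y) -> y = f x].
Proof.
move=> [/bounded_op_gr[f [-> _]] /selfadjoint_gr fs fc BA]; exists f; split=> //.
- by move=> h; rewrite -(contractive_sq ip_norm) //; apply: fc.
- by move=> x y /BA.
Qed.

(** A nonempty range rules out the default value of [xget], so the square root exists. *)
Lemma op_sqrtP (A : graph H) : op_ran (op_sqrt ip A) !=set0 ->
  exists2 f : {linear H -> H}, op_sqrt ip A = gr f &
   [/\ forall x y, ip (f x) y = ip x (f y), (exists2 c, 0 <= c &
     forall x, sq (f x) <= c * sq x) & A = gr (f \o f)].
Proof.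
move=> [y [x]]; rewrite /op_sqrt.
case: xgetP => [_ -> /= [/bounded_op_gr[f [-> fb]] /selfadjoint_gr fs _ <-] _|//].
exists f => //; split=> //; apply/seteqP; split=> [[u v] /= [_ /= -> ->] //|].
by move=> [u v] /= ->; exists (f u).
Qed.

Lemma nonneg_gr f : op_nonneg ip (gr f) -> forall x, 0 <= rip (f x) x.
Proof. by move=> h x; have := h x (f x) erefl; rewrite lecE => /andP[]. Qed.

Lemma op_ker_gr f : op_ker (gr f) = [set x | f x = 0].
Proof. by apply/seteqP; split=> x; rewrite /op_ker /= => ->. Qed.

Lemma op_ran_gr f : op_ran (gr f) = range f.
Proof. by apply/seteqP; split=> y [x]; [move=> /= ->|move=> _ <-]; exists x. Qed.

Lemma op_dom_cayley (b : H -> H) x :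
  op_dom (cayley (gr b)) x <-> exists y, x = y + b y.
Proof.
split=> [[z [y [y1 [y2 [h1 h2 h3]]] _]]|[y ->]].
  by exists y; move: h1 h2 h3; rewrite /op_id /= => -> -> ->.
exists (y - b y); exists y => /=.
  by exists y, (b y); split.
by exists y, (- b y); split=> //; exists (b y) => //=; rewrite scaleN1r.
Qed.

Section OnOrthogonalComplement.
Variable D : set H.
Local Notation N := (orthocompl ip D).

Lemma orthocompl_lin (a : R[i]) x y : N x -> N y -> N (a *: x + y).
Proof. by move=> Nx Ny z Dz; rewrite ipDl ipZl Nx // Ny // mulr0 addr0. Qed.

Lemma orthocompl0 : N 0.
Proof. by move=> z _; rewrite linear0l. Qed.

Definition gr_on (f : H -> H) : graph H := op_restr (gr f) N.

Lemma bounded_op_on (f : H -> H) (C : R) : linear f ->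
  (forall x, N x -> N (f x)) -> 0 <= C -> (forall x, sq (f x) <= C * sq x) ->
  bounded_op N (gr_on f).
Proof.
move=> fl fN C0 fC.
have f0 : f 0 = 0 by have := fl (-1) 0 0; rewrite scaler0 addr0 scaleN1r addNr.
split.
- split=> [|x y z [_ /= ->] [_ /= ->] //]; split; first exact: (conj orthocompl0).
  move=> a x y z t [/= Nx ->] [/= Nz ->]; split=> /=; first exact: orthocompl_lin.
  by rewrite fl.
- by apply/seteqP; split=> [x [y []]|x Nx] //; exists (f x).
- by move=> y [x [/= Nx ->]]; exact: fN.
- exists (Num.sqrt C) => x y [/= _ ->].
  by rewrite (norm_le_sq ip_norm) ?sqrtr_ge0 // sqr_sqrtr.
Qed.

Lemma op_val_on f x : N x -> op_val (gr_on f) x = f x.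
Proof.
move=> Nx; rewrite /op_val; case: xgetP => [y -> /= [_ /= ->] //|].
by move=> /(_ (f x)) /=; case.
Qed.

Lemma op_adj_on (f f' : H -> H) : (forall x y, ip (f x) y = ip x (f' y)) ->
  (forall x, N x -> N (f' x)) -> op_adj ip N (gr_on f) = gr_on f'.
Proof.
move=> ff' f'N; apply/seteqP; split=> [[x y] /= [Nx Ny h]|[x y] [/= Nx ->]].
  split=> //=; apply/eqP; rewrite -subr_eq0; apply/eqP/(sq_eq0 ip_norm).
  (* The difference lies in [N], so it may itself serve as the test vector and is then orthogonal to
     itself. *)
  have Nd : N (y - f' x).
    by rewrite addrC -scaleN1r; apply: orthocompl_lin => //; apply: f'N.
  have := h (y - f' x) (f (y - f' x)) (conj Nd erefl).
  rewrite ff' => e; rewrite /sq ripDr ripNr.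
  by rewrite /rip e subrr.
by split=> //; [exact: f'N | move=> u v [/= _ ->]].
Qed.

Lemma op_im_nonneg_on (f : H -> H) (a : R) :
  (exists2 f', (forall x y, ip (f x) y = ip x (f' y)) & forall x, N x -> N (f' x)) ->
  (forall x, 0 <= a * complex.Im (ip (f x) x)) ->
  op_nonneg ip (op_scale a%:C (op_im ip N (gr_on f))).
Proof.
move=> [f' ff' f'N] hf x z; rewrite /op_im (op_adj_on ff' f'N).
move=> [w [w' [y1 [y2 [[_ h1] [y3 [_ h2] h3] h4]]] h5] h6].
move: h1 h2 h3 h4 h5 h6 => /= -> -> -> -> -> ->.
rewrite !ipZl scaleN1r ipDl ipNl (ipC ip (f' x) x) -ff'.
have := hf x; case: (ip (f x) x) => p q /= h.
rewrite (_ : _ * _ = (a * q)%:C) ?ler0c //.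
have -> : (p +i* q) - Num.conj (p +i* q) = (2 * 'i) * q%:C.
  by apply/eqP; rewrite eq_complex /=; apply/andP; split; apply/eqP; ring.
rewrite mulKf ?rmorphM //.
by rewrite mulf_neq0 // ?pnatr_eq0 // eq_complex /= oner_eq0 andbF.
Qed.

Lemma op_inv_on f f' : cancel f f' -> cancel f' f ->
  (forall x, N x -> N (f x)) -> (forall x, N x -> N (f' x)) ->
  op_inv (gr_on f) = gr_on f'.
Proof.
move=> fK f'K fN f'N; apply/seteqP; split=> -[x y] [/= Nx ->].
  by split=> /=; [exact: fN | rewrite fK].
by split=> /=; [exact: f'N | rewrite f'K].
Qed.

Lemma op_comp_on f f' : (forall x, f (f' x) = - x) -> (forall x, N x -> N (f' x)) ->
  op_comp (gr_on f) (gr_on f') = op_scale (-1) (op_restr op_id N).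
Proof.
move=> ff' f'N; apply/seteqP; split=> [[x y] [z [/= Nx ->] [/= _ ->]]|].
  by exists x => //=; rewrite ff' scaleN1r.
move=> [x y] [z [Nx xz] yz]; move: Nx xz yz; rewrite /op_id /= => Nx -> ->.
exists (f' x); split=> //=; first exact: f'N.
by rewrite ff' scaleN1r.
Qed.

End OnOrthogonalComplement.

Variables b X : {linear H -> H}.
Variable r : R[i] -> {linear H -> H}.
Hypothesis rP : forall l, slit_plane l ->
  cancel (r l) (pencil b l) /\ cancel (pencil b l) (r l).

Lemma Q_fun_gr D s l : slit_plane l ->
  Q_fun (orthocompl ip D) s (gr X) (cayley (gr b)) l = gr_on D (qfun X r s l).
Proof.
move=> sl; have [rK Kr] := rP sl.
(* Parametrizing the domain of the Cayley transform as k + b k turns S - l into the pencil acting on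
   k, whence k = r_l (X x). *)
have pE k : k - b k - l *: (k + b k) = pencil b l k.
  by apply: (ip_eq ip_norm) => z; rewrite /pencil !(ipDl, ipNl, ipZl); ring.
have wE k : pencil b l k + (l + 1) *: (k + b k) = 2 *: k.
  by apply: (ip_eq ip_norm) => z; rewrite /pencil !(ipDl, ipNl, ipZl); ring.
apply/seteqP; split=> [[x y] [Nx]|[x y] [/= Nx ->]].
  move=> [y1 [y2 [[t1 e1 e2] [t2 [w [u e3 [y3 [y4 [e4 [k hk e8] e9]]]] e5] e6] e7]]].
  move: hk => [y5 [y6 [[h [z1 [z2 [f1 f2 f3]]] [z3 [z4 [f4 [z5 f5 f6] f7]]]]
    [t3 [t4 f8 f9] f10] f11]]].
  move: e1 e2 e3 e4 e5 e6 e7 e8 e9; rewrite /op_id /= => -> -> e3 -> -> -> -> -> ->.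
  move: f1 f2 f3 f4 f5 f6 f7 f8 f9 f10 f11; rewrite /op_id /=.
  move=> -> -> -> -> -> -> -> -> -> -> f11; move: f11 e3; rewrite !scaleN1r.
  rewrite pE => -> e; split=> //=; rewrite /qfun wE -e.
  rewrite Kr (linearZ_LR X) scalerA; congr (_ + _ *: _).
  by rewrite divfK // pnatr_eq0.
split=> //=; exists (s *: x), ((l + 1) *: X (r l (X x))); split=> //.
  by exists x.
exists (X (2 *: r l (X x))); last first.
  by rewrite (linearZ_LR X) scalerA; congr (_ *: _); rewrite divfK // pnatr_eq0.
exists (2 *: r l (X x)) => //=; exists (X x) => //=.
exists (X x), ((l + 1) *: (r l (X x) + b (r l (X x)))); split=> //.
  exists (r l (X x) + b (r l (X x))) => //=.
  exists (r l (X x) - b (r l (X x))), (- (l *: (r l (X x) + b (r l (X x))))).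
  split=> /=.
  - exists (r l (X x)); first by exists (r l (X x)), (b (r l (X x))).
    exists (r l (X x)), (- b (r l (X x))); split=> //.
    by exists (b (r l (X x))) => //=; rewrite scaleN1r.
  - exists (l *: (r l (X x) + b (r l (X x)))); last by rewrite scaleN1r.
    by exists (r l (X x) + b (r l (X x))).
  - by rewrite pE rK.
by rewrite -wE rK.
Qed.

End GraphsOfMaps.

(** * The classes S_F and S_K *)

Section Herglotz.
Context {R : realType} {H : completeNormedModType R[i]}.
Variable ip : {dot H for @Num.conj R[i]}.
Hypothesis ip_norm : hilbert_dot ip.
Local Notation rip := (rip ip).
Local Notation sq := (sq ip).

Variables b X : {linear H -> H}.
Hypothesis b_sym : forall x y, ip (b x) y = ip x (b y).
Hypothesis b_le : forall h, sq (b h) <= sq h.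
Hypothesis X_sym : forall x y, ip (X x) y = ip x (X y).
Variable c : R.
Hypothesis X_bound : forall u, sq (X u) <= c * sq u.
Hypothesis c_ge0 : 0 <= c.
Variable r : R[i] -> {linear H -> H}.
Hypothesis rP : forall l, slit_plane l ->
  cancel (r l) (pencil b l) /\ cancel (pencil b l) (r l).
Variable D : set H.
Local Notation N := (orthocompl ip D).
Hypothesis XN : forall x, N (X x).

Lemma qfun_on s l x : N x -> N (qfun X r s l x).
Proof.
move=> Nx; apply: orthocompl_lin => //; rewrite -[_ *: _]addr0.
by apply: orthocompl_lin => //; exact: orthocompl0.
Qed.

Lemma qfun'_on l x : N (qfun' b X r l x).
Proof. by rewrite /qfun' addrC; apply: orthocompl_lin. Qed.

Lemma qfun_herglotz (s : R) :
  herglotz_nevanlinna ip N (Q_fun N s%:C (gr X) (cayley (gr b))).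
Proof.
move=> l sl; have slc := slit_plane_conj sl.
have adj x y : ip (qfun X r s%:C l x) y = ip x (qfun X r s%:C (Num.conj l) y).
  rewrite (qfun_adj b_sym X_sym rP) //; congr (ip x (qfun _ _ _ _ _)).
  by apply/eqP; rewrite eq_complex /= oppr0 !eqxx.
rewrite !(Q_fun_gr ip_norm _ rP) //; split.
- have [C C0 hC] := qfun_bound ip_norm b_sym b_le X_bound c_ge0 rP s%:C sl.
  apply: (bounded_op_on ip_norm (qfun_linear _ _ _ _) _ C0 hC) => x.
  exact: qfun_on.
- exists (gr_on ip D (qfun' b X r l)).
    have [C C0 hC] := qfun'_bound ip_norm b_sym b_le X_bound c_ge0 rP sl.
    apply: (bounded_op_on ip_norm (qfun'_linear _ _ _ _) _ C0 hC) => x _.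
    exact: qfun'_on.
  move=> _ /posC[e e0 ->].
  have [C [d [C0 d0 hC]]] := qfun_derive ip_norm b_sym b_le X_bound c_ge0 rP s%:C sl.
  have C1 : 0 < C + 1 by rewrite ltr_wpDl.
  (* It suffices that C (e / (C + 1))^2 <= e^2; C + 1 also covers C = 0. *)
  exists (Num.min d (e / (C + 1)))%:C.
    by rewrite ltcR lt_min d0 divr_gt0.
  move=> m /andP[ml0 ml] g Ng.
  have mnl : m != l by rewrite -subr_eq0 -normr_gt0.
  have md : `|m - l| < d%:C.
    by apply: lt_le_trans ml _; rewrite lecR ge_min lexx.
  have me : `|m - l| < (e / (C + 1))%:C.
    by apply: lt_le_trans ml _; rewrite lecR ge_min lexx orbT.
  have [sm hm] := hC m mnl md.
  rewrite !(Q_fun_gr ip_norm _ rP) // !op_val_on //.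
  rewrite (norm_le_sq ip_norm) ?(ltW e0) //; apply: le_trans (hm g) _.
  rewrite mulrA ler_wpM2r ?sq_ge0 //.
  have h1 : complex.Re (m - l) ^+ 2 + complex.Im (m - l) ^+ 2 <= (e / (C + 1)) ^+ 2.
    rewrite -lecR add_Re2_Im2 rmorphXn /= ler_pXn2r ?nnegrE ?(ltW me) //.
    by rewrite ler0c ltW // divr_gt0.
  apply: le_trans (ler_wpM2r C0 h1) _.
  have {2}-> : e = e / (C + 1) * (C + 1) by rewrite divfK // gt_eqF.
  by rewrite [leRHS]exprMn ler_wpM2l ?sqr_ge0 // sqrrD1; have := sqr_ge0 C; lra.
- rewrite (op_adj_on ip_norm adj) // => x; exact: qfun_on.
- apply: op_im_nonneg_on => //; last by move=> x; apply: (qfun_im ip_norm b_sym X_sym rP).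
  by exists (qfun X r s%:C (Num.conj l)) => // x; apply: qfun_on.
Qed.

End Herglotz.

(* The Cayley transform (1 - x) / (1 + x) equals 1 + e at x = near0 e and
   - (1 + e) at x = nearNy e. *)
Definition near0 (R : realType) (e : R) : R := - e / (2 + e).
Definition nearNy (R : realType) (e : R) : R := - (2 + e) / e.

Lemma slit_near0 (R : realType) (e : R) : 0 < e -> slit_plane (near0 e)%:C.
Proof.
move=> e0; apply/slit_planeP; exists 0; rewrite /= mulr0 sub0r /near0 mulNr opprK.
by rewrite divr_gt0 // addr_gt0.
Qed.

Lemma slit_nearNy (R : realType) (e : R) : 0 < e -> slit_plane (nearNy e)%:C.
Proof.
move=> e0; apply/slit_planeP; exists 0; rewrite /= mulr0 sub0r /nearNy mulNr opprK.
by rewrite divr_gt0 // addr_gt0.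
Qed.

(** [near0] maps the positive axis bijectively onto ]-1, 0[, with inverse - 2 x / (1 + x). *)
Lemma at_left0P (R : realType) (P : R -> Prop) :
  (exists2 e0, 0 < e0 & forall e, 0 < e -> e < e0 -> P (near0 e)) ->
  \forall x \near 0^'-, P x.
Proof.
move=> [e0 e00 he].
have lo : - e0 / (2 + e0) < 0 by rewrite mulNr oppr_lt0 divr_gt0 // addr_gt0.
near=> x.
have x0 : x < 0 by near: x; exact: nbhs_left_lt.
have xe : - e0 / (2 + e0) < x by near: x; exact: nbhs_left_gt.
move: xe; rewrite ltr_pdivrMr ?addr_gt0 // => xe.
have x1 : 0 < 1 + x.
  rewrite ltNge; apply/negP => h; have h' : 0 <= - (1 + x) by rewrite oppr_ge0.
  by have := mulr_ge0 (ltW e00) h'; lra.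
have -> : x = near0 (- 2 * x / (1 + x)).
  by rewrite /near0; field; rewrite !gt_eqF //; lra.
apply: he; first by rewrite divr_gt0 //; lra.
by rewrite ltr_pdivrMr //; lra.
Unshelve. all: by end_near. Qed.

(** [nearNy] maps the positive axis bijectively onto ]-oo, -1[, with inverse - 2 / (1 + x). *)
Lemma nearNyP (R : realType) (P : R -> Prop) :
  (exists2 e0, 0 < e0 & forall e, 0 < e -> e < e0 -> P (nearNy e)) ->
  \forall x \near -oo, P x.
Proof.
move=> [e0 e00 he]; near=> x.
have xe : x < - (2 + e0) / e0 by near: x; apply: nbhs_ninfty_lt; exact: num_real.
move: xe; rewrite ltr_pdivlMr // => xe.
have x1 : 0 < - (1 + x).
  rewrite ltNge; apply/negP => h; have h' : 0 <= 1 + x by rewrite -oppr_le0.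
  by have := mulr_ge0 (ltW e00) h'; lra.
have x1' : 1 + x != 0 by rewrite -oppr_eq0 gt_eqF.
have -> : x = nearNy (2 / - (1 + x)).
  by rewrite /nearNy; field; rewrite x1'.
apply: he; first by rewrite divr_gt0.
by rewrite ltr_pdivrMr //; lra.
Unshelve. all: by end_near. Qed.

(** * The two functions together: inversion and limits at both ends *)

Section Pair.
Context {R : realType} {H : completeNormedModType R[i]}.
Variable ip : {dot H for @Num.conj R[i]}.
Hypothesis ip_norm : hilbert_dot ip.
Local Notation rip := (rip ip).
Local Notation sq := (sq ip).

(** The pencils differ by (l + 1) (b' - b), so (l + 1) r X^2 r' = s (r' - r); this cancels the two
    mixed terms of the product and leaves - s^2. The sign s = 1 or -1 covers both orders. *)
Lemma qfun_mul (b b' X : {linear H -> H}) (r r' : R[i] -> {linear H -> H})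
    (s l : R[i]) (g : H) :
  cancel (pencil b l) (r l) -> cancel (r' l) (pencil b' l) ->
  (forall h, X (X h) = s *: (b' h - b h)) -> s ^+ 2 = 1 ->
  qfun X r (- s) l (qfun X r' s l g) = - g.
Proof.
move=> Kr rK XX s2; rewrite /qfun.
set v := X g; set u := r' l v.
have E : (l + 1) *: r l (X (X u)) = s *: (u - r l v).
  rewrite -(linearZ_LR (r l)) -(rK v) -/u -{2}(Kr u) -(linearB (r l)).
  rewrite -(linearZ_LR (r l)) XX; congr (r l _); rewrite /pencil.
  by apply: (ip_eq ip_norm) => z; rewrite !(ipDl, ipNl, ipZl); ring.
rewrite (linearD X) !(linearZ_LR X) -/v -/u (linearD (r l)) !(linearZ_LR (r l)).
rewrite E (linearD X) !(linearZ_LR X) (linearB X).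
apply: (ip_eq ip_norm) => z; rewrite !(ipDl, ipNl, ipZl).
by ring: s2.
Qed.

Variables b0 b1 X : {linear H -> H}.
Hypothesis b0_sym : forall x y, ip (b0 x) y = ip x (b0 y).
Hypothesis b0_le : forall h, sq (b0 h) <= sq h.
Hypothesis b1_sym : forall x y, ip (b1 x) y = ip x (b1 y).
Hypothesis b1_le : forall h, sq (b1 h) <= sq h.
Hypothesis X_sym : forall x y, ip (X x) y = ip x (X y).
Hypothesis XX : forall h, X (X h) = b1 h - b0 h.
Variables r0 r1 : R[i] -> {linear H -> H}.
Hypothesis r0P : forall l, slit_plane l ->
  cancel (r0 l) (pencil b0 l) /\ cancel (pencil b0 l) (r0 l).
Hypothesis r1P : forall l, slit_plane l ->
  cancel (r1 l) (pencil b1 l) /\ cancel (pencil b1 l) (r1 l).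

Local Notation Q0 := (qfun X r0 (-1)).
Local Notation Q1 := (qfun X r1 1).

Lemma Q0Q1 l g : slit_plane l -> Q0 l (Q1 l g) = - g.
Proof.
move=> sl; have [_ Kr] := r0P sl; have [rK _] := r1P sl.
by apply: (qfun_mul _ Kr rK); rewrite ?expr1n // => h; rewrite XX scale1r.
Qed.

Lemma Q1Q0 l g : slit_plane l -> Q1 l (Q0 l g) = - g.
Proof.
move=> sl; have [_ Kr] := r1P sl; have [rK _] := r0P sl.
rewrite -{1}(opprK 1); apply: (qfun_mul _ Kr rK); rewrite ?sqrrN ?expr1n // => h.
by rewrite XX scaleN1r opprB.
Qed.

Let rip_sym (f : {linear H -> H}) : (forall x y, ip (f x) y = ip x (f y)) ->
  forall x y, rip (f x) y = rip x (f y).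
Proof. by move=> fs x y; rewrite /rip fs. Qed.

(** At x = near0 e the pencil of b1 is (1 + x) (1 + e - b1), so this is (1 + e - b1)^-1. *)
Let G1 (e : R) (v : H) : H := (1 + near0 e)%:C *: r1 (near0 e)%:C v.
Let F1 (e : R) : H -> H := Q1 (near0 e)%:C.
Let K1 (e : R) (g : H) : H := - Q0 (near0 e)%:C g.

Let shiftG1 e v : 0 < e -> shift b1 e (G1 e v) = v.
Proof.
move=> e0; have e2 : 2 + e != 0 by rewrite gt_eqF // addr_gt0.
have [rK _] := r1P (slit_near0 e0); rewrite -[RHS]rK /shift /G1 /pencil.
rewrite (linearZ_LR b1) scalerA -!rmorphM /=; congr (_ *: _ - _ *: _).
  by rewrite -(rmorphB _ 1) /=; congr (_%:C); rewrite /near0; field.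
by rewrite -(rmorphD _ 1).
Qed.

Let FE1 e g : 0 < e -> F1 e g = g + X (G1 e (X g)).
Proof.
move=> e0; rewrite /F1 /qfun /G1 scale1r (linearZ_LR X); congr (_ + _ *: _).
by rewrite rmorphD addrC.
Qed.

Let FK1 e g : 0 < e -> F1 e (K1 e g) = g.
Proof.
by move=> e0; rewrite /F1 /K1 qfunN Q1Q0 ?opprK //; exact: slit_near0.
Qed.

(** At x = nearNy e, 1 + x = - 2 / e is negative and the pencil of b0 is - (1 + x) (1 + e + b0);
    hence T = - b0 and the sign change in [F0]. *)
Let b0N : {linear H -> H} := \- b0.
Let G0 (e : R) (v : H) : H := (- (1 + nearNy e))%:C *: r0 (nearNy e)%:C v.
Let F0 (e : R) (g : H) : H := - Q0 (nearNy e)%:C g.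
Let K0 (e : R) : H -> H := Q1 (nearNy e)%:C.

Let shiftG0 e v : 0 < e -> shift b0N e (G0 e v) = v.
Proof.
move=> e0; have e1 : e != 0 by rewrite gt_eqF.
have [rK _] := r0P (slit_nearNy e0).
have E1 : 1 - (nearNy e)%:C = (1 + e)%:C * (- (1 + nearNy e))%:C.
  by rewrite -(rmorphB _ 1) -rmorphM /=; congr (_%:C); rewrite /nearNy; field.
have E2 : 1 + (nearNy e)%:C = - (- (1 + nearNy e))%:C.
  by rewrite rmorphN opprK rmorphD.
rewrite -[RHS]rK /pencil E1 E2 scaleNr opprK /shift /G0 (linearZ_LR b0N) /=.
by rewrite scalerN opprK scalerA.
Qed.

Let FE0 e g : 0 < e -> F0 e g = g + X (G0 e (X g)).
Proof.
move=> e0; rewrite /F0 /qfun /G0 scaleN1r opprD opprK (linearZ_LR X) -scaleNr.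
by congr (_ + _ *: _); rewrite rmorphN rmorphD addrC.
Qed.

Let FK0 e g : 0 < e -> F0 e (K0 e g) = g.
Proof. by move=> e0; rewrite /F0 /K0 Q0Q1 ?opprK //; exact: slit_nearNy. Qed.

Let b1_sym' := rip_sym b1_sym.
Let X_sym' := rip_sym X_sym.
Let b0N_sym x y : rip (b0N x) y = rip x (b0N y).
Proof. by rewrite /= !ripE (rip_sym b0_sym). Qed.
Let b0N_form h : `|rip (b0N h) h| <= sq h.
Proof. by rewrite /= ripNl normrN; exact: contraction_form. Qed.
Let b1_form := contraction_form ip_norm b1_le.

Lemma Q1_form_bound g M :
  (forall e, 0 < e -> rip (Q1 (near0 e)%:C g) g <= M) ->
  forall h, 2 * rip (X g) h - (sq h - rip (b1 h) h) <= M.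
Proof. exact: (F_bounded_form ip_norm b1_sym' b1_form X_sym' shiftG1 FE1). Qed.

Lemma Q0_form_bound g M :
  (forall e, 0 < e -> rip (- Q0 (nearNy e)%:C g) g <= M) ->
  forall h, 2 * rip (X g) h - (sq h - rip (- b0 h) h) <= M.
Proof. exact: (F_bounded_form ip_norm b0N_sym b0N_form X_sym' shiftG0 FE0). Qed.

Section At0.
Hypothesis Q1_unbounded : forall g M,
  (forall e, 0 < e -> rip (Q1 (near0 e)%:C g) g <= M) -> X g = 0.

Lemma Q1_form_cvg g M : X g != 0 -> exists2 e0, 0 < e0 &
  forall e, 0 < e -> e < e0 -> M <= rip (Q1 (near0 e)%:C g) g.
Proof. exact: (F_cvg_pinfty ip_norm b1_sym' b1_form X_sym' shiftG1 FE1 Q1_unbounded). Qed.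

Lemma Q0_cvg0 g d : (forall y, X y = 0 -> rip g y = 0) -> 0 < d ->
  exists2 e0, 0 < e0 & forall e, 0 < e -> e < e0 -> sq (Q0 (near0 e)%:C g) < d.
Proof.
move=> gX d0; have [e0 e00 he] :=
  K_cvg0 ip_norm b1_sym' b1_form X_sym' shiftG1 FE1 FK1 Q1_unbounded gX d0.
by exists e0 => // e ep /he; rewrite /K1 sqN; apply.
Qed.
End At0.

Section AtNy.
Hypothesis Q0_unbounded : forall g M,
  (forall e, 0 < e -> rip (- Q0 (nearNy e)%:C g) g <= M) -> X g = 0.
Hypothesis dense_ran : forall f d, 0 < d -> exists h, sq (f - (h + b0 h)) < d.
Variable c : R.
Hypothesis X_bound : forall u, sq (X u) <= c * sq u.

Lemma Q0_form_cvg g M : X g != 0 -> exists2 e0, 0 < e0 &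
  forall e, 0 < e -> e < e0 -> M <= rip (- Q0 (nearNy e)%:C g) g.
Proof. exact: (F_cvg_pinfty ip_norm b0N_sym b0N_form X_sym' shiftG0 FE0 Q0_unbounded). Qed.

Lemma Q1_cvg0 g d : (forall y, X y = 0 -> rip g y = 0) -> 0 < d ->
  exists2 e0, 0 < e0 & forall e, 0 < e -> e < e0 -> sq (Q1 (nearNy e)%:C g) < d.
Proof.
by move=> gX; apply: (K_cvg0 ip_norm b0N_sym b0N_form X_sym' shiftG0 FE0 FK0 Q0_unbounded).
Qed.

Let dense_ran' f d : 0 < d -> exists h, sq (f - (h - b0N h)) < d.
Proof. by move=> /(dense_ran f)[h hh]; exists h; rewrite /= opprK. Qed.

Lemma scale_Q0_cvg0 g d : 0 < d -> exists2 e0, 0 < e0 &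
  forall e, 0 < e -> e < e0 -> e ^+ 2 * sq (Q0 (nearNy e)%:C g) < d.
Proof.
move=> d0; have [e0 e00 he] := scale_F_cvg0 ip_norm b0N_form shiftG0 FE0
  dense_ran' X_bound g d0.
by exists e0 => // e ep /he; rewrite /F0 sqN; apply.
Qed.

Lemma Q1_div_cvg g M : g != 0 -> exists2 e0, 0 < e0 &
  forall e, 0 < e -> e < e0 -> M * e <= rip (Q1 (nearNy e)%:C g) g.
Proof.
exact: (K_div_cvg_pinfty ip_norm b0N_sym b0N_form X_sym' shiftG0 FE0 FK0 dense_ran' X_bound).
Qed.
End AtNy.

Variable D : set H.
Local Notation N := (orthocompl ip D).
Hypothesis DX : forall h, D h <-> X h = 0.
Hypothesis Q1_unbounded : forall g M,
  (forall e, 0 < e -> rip (Q1 (near0 e)%:C g) g <= M) -> X g = 0.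
Hypothesis Q0_unbounded : forall g M,
  (forall e, 0 < e -> rip (- Q0 (nearNy e)%:C g) g <= M) -> X g = 0.
Hypothesis dense_ran : forall f d, 0 < d -> exists h, sq (f - (h + b0 h)) < d.
Variable c : R.
Hypothesis X_bound : forall u, sq (X u) <= c * sq u.
Hypothesis c_ge0 : 0 <= c.

Local Notation M0 := (Q_fun N (-1) (gr X) (cayley (gr b0))).
Local Notation M1 := (Q_fun N 1 (gr X) (cayley (gr b1))).

Let XN x : N (X x).
Proof. by move=> y /DX Xy; rewrite X_sym Xy linear0r. Qed.

Let N_ker g : N g -> forall y, X y = 0 -> rip g y = 0.
Proof. by move=> Ng y /DX Dy; rewrite /rip Ng. Qed.

Let N_X g : N g -> g != 0 -> X g != 0.
Proof.
move=> Ng; apply: contra => /eqP Xg.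
by apply/eqP/(sq_eq0 ip_norm); exact: N_ker.
Qed.

Lemma M0E l : slit_plane l -> M0 l = gr_on ip D (Q0 l).
Proof. exact: Q_fun_gr. Qed.

Lemma M1E l : slit_plane l -> M1 l = gr_on ip D (Q1 l).
Proof. exact: Q_fun_gr. Qed.

Let Q0N l g : N g -> N (Q0 l g). Proof. exact: qfun_on. Qed.
Let Q1N l g : N g -> N (Q1 l g). Proof. exact: qfun_on. Qed.

Let N_opp g : N g -> N (- g).
Proof.
move=> Ng; rewrite -scaleN1r -[_ *: _]addr0.
by apply: orthocompl_lin => //; exact: orthocompl0.
Qed.

Lemma class_SF_Q0 : class_SF ip N M0.
Proof.
split.
  have := qfun_herglotz ip_norm b0_sym b0_le X_sym X_bound c_ge0 r0P XN (-1).
  by rewrite rmorphN1.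
split=> [l sl|g Ng|g Ng g0|g Ng].
- have [C C0 hC] := qfun_bound ip_norm b1_sym b1_le X_bound c_ge0 r1P 1 sl.
  rewrite M0E // (@op_inv_on _ _ _ _ _ (fun g => - Q1 l g)).
  + apply: (bounded_op_on ip_norm _ _ C0) => [a x y|x Nx|x].
    * by rewrite qfun_linear opprD scalerN.
    * exact/N_opp/Q1N.
    * by rewrite sqN.
  + by move=> x; rewrite Q1Q0 ?opprK.
  + by move=> x; rewrite qfunN Q0Q1 ?opprK.
  + exact: Q0N.
  + by move=> x Nx; exact/N_opp/Q1N.
- apply/cvgr0Pnorm_lt => _ /posC[d d0 ->]; apply: at_left0P.
  have [e0 e00 he] := Q0_cvg0 Q1_unbounded (N_ker Ng) (exprn_gt0 2 d0).
  exists e0 => // e ep /(he _ ep); have sl := slit_near0 ep.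
  by rewrite M0E // op_val_on // (norm_lt_sq ip_norm).
- apply/cvgrNyPle => A; apply: nearNyP.
  have [e0 e00 he] := Q0_form_cvg Q0_unbounded (- A) (N_X Ng g0).
  exists e0 => // e ep /(he _ ep); have sl := slit_nearNy ep.
  by rewrite M0E // /op_form op_val_on // ripNl lerN2.
- apply/cvgr0Pnorm_lt => _ /posC[d d0 ->]; apply: nearNyP.
  have [e0 e00 he] := scale_Q0_cvg0 dense_ran X_bound g (exprn_gt0 2 d0).
  exists e0 => // e ep /(he _ ep); have sl := slit_nearNy ep.
  rewrite M0E // op_val_on // (norm_lt_sq ip_norm) // -fmorphV sqZr //.
  apply: le_lt_trans; rewrite ler_wpM2r ?sq_ge0 //.
  have e2 : 0 < 2 + e by rewrite addr_gt0.
  (* Here |x^-1| = e / (2 + e) <= e, so the convergence of e Q0 g to 0 is enough. *)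
  have -> : (nearNy e)^-1 = - (e / (2 + e)).
    by rewrite /nearNy mulNr invrN invf_div.
  rewrite sqrrN ler_pXn2r ?nnegrE ?divr_ge0 ?(ltW ep) ?(ltW e2) //.
  by rewrite ler_pdivrMr //; have := mulr_gt0 ep ep; lra.
Qed.

Lemma class_SK_Q1 : class_SK ip N M1.
Proof.
split.
  have := qfun_herglotz ip_norm b1_sym b1_le X_sym X_bound c_ge0 r1P XN 1.
  by rewrite rmorph1.
split=> [l sl|g Ng g0|g Ng|g Ng g0].
- have [C C0 hC] := qfun_bound ip_norm b0_sym b0_le X_bound c_ge0 r0P (-1) sl.
  rewrite M1E // (@op_inv_on _ _ _ _ _ (fun g => - Q0 l g)).
  + apply: (bounded_op_on ip_norm _ _ C0) => [a x y|x Nx|x].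
    * by rewrite qfun_linear opprD scalerN.
    * exact/N_opp/Q0N.
    * by rewrite sqN.
  + by move=> x; rewrite Q0Q1 ?opprK.
  + by move=> x; rewrite qfunN Q1Q0 ?opprK.
  + exact: Q1N.
  + by move=> x Nx; exact/N_opp/Q0N.
- apply/cvgryPge => A; apply: at_left0P.
  have [e0 e00 he] := Q1_form_cvg Q1_unbounded A (N_X Ng g0).
  exists e0 => // e ep /(he _ ep); have sl := slit_near0 ep.
  by rewrite M1E // /op_form op_val_on.
- apply/cvgr0Pnorm_lt => _ /posC[d d0 ->]; apply: nearNyP.
  have [e0 e00 he] := Q1_cvg0 Q0_unbounded (N_ker Ng) (exprn_gt0 2 d0).
  exists e0 => // e ep /(he _ ep); have sl := slit_nearNy ep.
  by rewrite M1E // op_val_on // (norm_lt_sq ip_norm).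
- apply/cvgrNyPle => A; apply: nearNyP.
  have [e0 e00 he] := Q1_div_cvg dense_ran X_bound `|A| g0.
  exists e0 => // e ep /(he _ ep); have sl := slit_nearNy ep.
  rewrite M1E // /op_form op_val_on // -/(rip (Q1 (nearNy e)%:C g) g) => h.
  (* Since x = - (2 + e) / e, this gives x (Q1 g, g) <= - 2 |A| - e |A| <= A. *)
  have h1 : `|A| * (2 + e) <= (2 + e) / e * rip (Q1 (nearNy e)%:C g) g.
    have -> : `|A| * (2 + e) = (2 + e) / e * (`|A| * e) by field; rewrite gt_eqF.
    by rewrite ler_wpM2l // divr_ge0 ?addr_ge0 // ltW.
  move: h1; move: (rip _ _) => z h1; rewrite /nearNy !mulNr.
  have := mulr_ge0 (normr_ge0 A) (ltW ep); have := ler_norm (- A).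
  by have := normr_ge0 A; rewrite normrN; lra.
Qed.

End Pair.

(** A nonempty difference excludes the empty default graph, so the extremal extension exists; the
    same holds for [B_MP]. *)
Lemma B_muP (R : realType) (H : completeNormedModType R[i])
    (ip : {dot H for @Num.conj R[i]}) (B A : graph H) :
  op_sub A (B_mu ip B) !=set0 -> sc_extension ip B (B_mu ip B) /\
    forall A', sc_extension ip B A' -> op_le ip (B_mu ip B) A'.
Proof.
by rewrite /B_mu; case: xgetP => [A' _ ? _ //|_ [p [y1 [y2 [_ [y3 []]]]]]].
Qed.

Lemma B_MP (R : realType) (H : completeNormedModType R[i])
    (ip : {dot H for @Num.conj R[i]}) (B A : graph H) :
  op_sub (B_M ip B) A !=set0 -> sc_extension ip B (B_M ip B) /\
    forall A', sc_extension ip B A' -> op_le ip A' (B_M ip B).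
Proof.
by rewrite /B_M; case: xgetP => [A' _ ? _ //|_ [p [y1 [y2 []]]]].
Qed.

Theorem theorem6p3 (R : realType) (H : completeNormedModType R[i])
    (ip : {dot H for @Num.conj R[i]})
    (ip_norm : hilbert_dot ip)
    (sepH : separable H)
    (S : graph H)
    (S_op : is_operator S)
    (S_closed : closed S)
    (S_sym : symmetric_op ip S)
    (S_nonneg : op_nonneg ip S)
    (S_disj : exists S' S'' : graph H,
       [/\ nonneg_selfadjoint ip S', nonneg_selfadjoint ip S'',
           S `<=` S', S `<=` S'' & S' `&` S'' = S])
    (B0 B1 : graph H) :
  let B := cayley S in
  let N := orthocompl ip (op_dom B) in
  let X := op_sqrt ip (op_sub B1 B0) in
  let S0 := cayley B0 in
  let S1 := cayley B1 in
  let Q0 := Q_fun N (-1) X S0 in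
  let Q1 := Q_fun N 1 X S1 in
  sc_extension ip B B0 ->
  sc_extension ip B B1 ->
  op_le ip B0 B1 ->
  op_ker (op_sub B1 B0) = op_dom B ->
  op_ran X `&` op_ran (op_sqrt ip (op_sub B0 (B_mu ip B))) = [set 0] ->
  op_ran X `&` op_ran (op_sqrt ip (op_sub (B_M ip B) B1)) = [set 0] ->
  nonneg_selfadjoint ip S0 ->
  nonneg_selfadjoint ip S1 ->
  [/\ class_SF ip N Q0,
      class_SK ip N Q1 &
      forall l : R[i], slit_plane l ->
        op_comp (Q0 l) (Q1 l) = op_scale (-1) (op_restr op_id N) /\
        op_comp (Q1 l) (Q0 l) = op_scale (-1) (op_restr op_id N)].
Proof.
move=> B N X S0 S1 Q0 Q1 sc0 sc1 le01 kerD ran0 ran1 sa0 sa1.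
have [b0 [E0 b0s b0c Bb0]] := sc_extensionP ip_norm sc0.
have [b1 [E1 b1s b1c Bb1]] := sc_extensionP ip_norm sc1.
subst B0 B1.
(* The range conditions put 0 in the range of each square root, which certifies its existence. *)
have Xne : op_ran X !=set0.
  by exists 0; have : [set 0] (0 : H) by []; rewrite -ran0 => -[].
have [x Xx [xs [c c0 xc] xxE]] := op_sqrtP ip_norm Xne.
have xx h : x (x h) = b1 h - b0 h.
  by have : gr (x \o x) (h, x (x h)) by []; rewrite -xxE op_sub_gr.
have Dx h : op_dom B h <-> x h = 0.
  rewrite -kerD xxE op_ker_gr /=; split=> [xxh|->]; last exact: linear0.
  by apply: (sq_eq0 ip_norm); rewrite /sq /rip -xs xxh linear0l.
have Dx0 g y : op_dom B y -> ip y (x g) = 0.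
  by move=> /Dx xy; rewrite -xs xy linear0l.
have [r0 r0P] := resolvent_exists ip_norm b0s b0c.
have [r1 r1P] := resolvent_exists ip_norm b1s b1c.
have unb1 g M : (forall e, 0 < e -> rip ip (qfun x r1 1 (near0 e)%:C g) g <= M) ->
    x g = 0.
  move=> /(Q1_form_bound ip_norm b1s b1c xs r1P) hM.
  have Yne : op_ran (op_sqrt ip (op_sub (B_M ip B) (gr b1))) !=set0.
    by exists 0; have : [set 0] (0 : H) by []; rewrite -ran1 => -[].
  have [y Yy [ys _ yyE]] := op_sqrtP ip_norm Yne.
  have [|scM maxM] := @B_MP _ _ ip B (gr b1).
    by exists (0, y (y 0)); rewrite yyE.
  have [bM [EM bMs _ _]] := sc_extensionP ip_norm scM.
  rewrite EM in yyE.
  have [w xw] : exists w, x g = y w.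
    apply: (@dominated_vector_range _ _ _ ip_norm (op_dom B) b1 bM y (x g) M)
      => [u v||u v|h|z|A As Ac AD h|//].
    - by rewrite /rip b1s.
    - exact: (contraction_form ip_norm).
    - by rewrite /rip ys.
    - by have : gr (y \o y) (h, y (y h)) by []; rewrite -yyE op_sub_gr.
    - exact: Dx0.
    - have /maxM : sc_extension ip B (gr A).
        apply: (sc_extension_gr ip_norm (rip_sym_ip As) Ac) => u v Buv.
        by rewrite AD; [exact: Bb1 | exists v].
      rewrite EM /op_le op_sub_gr => /nonneg_gr/(_ h).
      by rewrite !ripE subr_ge0.
  suff : [set 0] (x g) by [].
  rewrite -ran1 /X Xx Yy !op_ran_gr.
  by split; [exists g | exists w].
have unb0 g M : (forall e, 0 < e ->
    rip ip (- qfun x r0 (-1) (nearNy e)%:C g) g <= M) -> x g = 0.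
  move=> /(Q0_form_bound ip_norm b0s b0c xs r0P) hM.
  have Yne : op_ran (op_sqrt ip (op_sub (gr b0) (B_mu ip B))) !=set0.
    by exists 0; have : [set 0] (0 : H) by []; rewrite -ran0 => -[].
  have [y Yy [ys _ yyE]] := op_sqrtP ip_norm Yne.
  have [|scm minm] := @B_muP _ _ ip B (gr b0).
    by exists (0, y (y 0)); rewrite yyE.
  have [bm [Em bms _ _]] := sc_extensionP ip_norm scm.
  rewrite Em in yyE.
  have [w xw] : exists w, x g = y w.
    (* Negation reverses the order: - B_mu is the largest contractive extension of - B, so the lemma
       used for B_M applies again. *)
    apply: (@dominated_vector_range _ _ _ ip_norm (op_dom B) (\- b0) (\- bm) y (x g) M)
      => [u v|h|u v|h|z|A As Ac AD h|//] /=.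
    - by rewrite !ripE /rip b0s.
    - by rewrite ripNl normrN; exact: (contraction_form ip_norm).
    - by rewrite /rip ys.
    - have : gr (y \o y) (h, y (y h)) by [].
      by rewrite -yyE op_sub_gr opprK addrC.
    - exact: Dx0.
    - have /minm : sc_extension ip B (gr (\- A)).
        apply: (sc_extension_gr ip_norm) => [u v|u|u v Buv] /=.
        + by rewrite ipNl (rip_sym_ip As) linearNr.
        + by rewrite sqN.
        + by rewrite AD ?opprK /=; [exact: Bb0 | exists v].
      rewrite Em /op_le op_sub_gr => /nonneg_gr/(_ h).
      by rewrite !ripE /=; lra.
  suff : [set 0] (x g) by [].
  rewrite -ran0 /X Xx Yy !op_ran_gr.
  by split; [exists g | exists w].
(* The range of I + b0 is the domain of S0, which is dense because S0 is a selfadjoint operator. *)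
have ran h d : 0 < d -> exists k, sq ip (h - (k + b0 k)) < d.
  move=> d0; case: sa0 => _ dense0 _ _.
  have sd : 0 < (Num.sqrt d)%:C by rewrite ltcR sqrtr_gt0.
  have [|k [kb /op_dom_cayley[u ku]]] := dense0 (ball h (Num.sqrt d)%:C) _ (ball_open _ _).
    by exists h; exact: ballxx.
  exists u; rewrite -ku; move: kb; rewrite -ball_normE /= (norm_lt_sq ip_norm).
    by rewrite sqr_sqrtr // ltW.
  by rewrite sqrtr_gt0.
rewrite /Q0 /Q1 /S0 /S1 /X Xx; split.
- exact: (class_SF_Q0 ip_norm b0s b0c b1s b1c xs xx r0P r1P Dx unb1 unb0 ran xc c0).
- exact: (class_SK_Q1 ip_norm b0s b0c b1s b1c xs xx r0P r1P Dx unb1 unb0 ran xc c0).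
- have xN u : orthocompl ip (op_dom B) (x u).
    by move=> z /Dx xz; rewrite xs xz linear0r.
  move=> l sl; rewrite /N (Q_fun_gr ip_norm _ r0P) // (Q_fun_gr ip_norm _ r1P) //.
  split; apply: op_comp_on => [h|h].
  + exact: (Q0Q1 ip_norm xx r0P).
  + exact: qfun_on.
  + exact: (Q1Q0 ip_norm xx r0P).
  + exact: qfun_on.
Qed.
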